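(* Let $(M^{2m+1},H(M),J)$, $m\ge1$, be an orientable strictly pseudoconvex CR manifold endowed with a pseudo-Hermitian structure $\theta$. Then the Ricci form $\rho_\theta$ satisfies $$d^W\rho_\theta=-(J\,{\rm Ric}^W(T))^\flat\wedge d\theta,$$ where $d^W$ is the horizontal exterior differential and $\flat$ is the dual with respect to $g_\theta$.
   Context: $M$ is a connected orientable manifold of dimension $2m+1$. A CR structure is a corank-one subbundle $H(M)\subset TM$ with an almost complex structure $J$ on $H(M)$ such that for $X,Y\in\Gamma(H(M))$ one has $[JX,Y]+[X,JY]\in\Gamma(H(M))$ and $[X,Y]-[JX,JY]+J([JX,Y]+[X,JY])=0$. It is strictly pseudoconvex if $H(M)$ is contact and the form $(X,Y)\mapsto -[X,JY] \bmod H(M)$ is definite. A pseudo-Hermitian structure is a $1$-form $\theta$ with $\ker\theta=H(M)$ such that $g_\theta(X,Y):=\frac12 d\theta(X,JY)$ is positive definite on $H(M)$. The characteristic vector field $T$ is given by $\theta(T)=1$, $T\lrcorner d\theta=0$; $TM=H(M)\oplus\mathbb RT$ with projection $\pi_\theta:TM\to H(M)$. Conventions: $d\theta(X,Y)=X\theta(Y)-Y\theta(X)-\theta([X,Y])$, so $d\theta(X,Y)=-2g_\theta(X,JY)$ on $H(M)$, and $(\alpha\wedge\beta)(X,Y)=\alpha(X)\beta(Y)-\alpha(Y)\beta(X)$ for $1$-forms. The Tanaka-Webster connection $\nabla^W$ is the linear connection on $TM$ with $\nabla^WT=0$, preserving $H(M)$, metric for $g_\theta$, with $\nabla^W_XY-\nabla^W_YX=\pi_\theta[X,Y]$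 and $\nabla^W_TX=\frac12([T,X]-J[T,JX])$ for $X,Y\in\Gamma(H(M))$. Curvature: $R^W(X,Y)=[\nabla^W_X,\nabla^W_Y]-\nabla^W_{[X,Y]}$. With $\{e_l\}_{l=1}^{2m}$ a local orthonormal frame of $H(M)$: ${\rm Ric}^W(X)=\sum_lR^W(X,e_l)e_l$ for $X\in TM$ (in particular ${\rm Ric}^W(T)\in H(M)$), and the Ricci form is $\rho_\theta(X,Y)=\frac12\sum_lg_\theta(R^W(Je_l,e_l)X,Y)$ for $X,Y\in H(M)$, extended by $T\lrcorner\rho_\theta=0$. Horizontal forms: $\Omega^k(H(M))=\{\omega\in\Omega^k(M): T\lrcorner\omega=0\}$. The horizontal exterior differential $d^W:\Omega^k(H(M))\to\Omega^{k+1}(H(M))$ is $(d^W\omega)(X_1,\dots,X_{k+1})=(d\omega)(\pi_\theta X_1,\dots,\pi_\theta X_{k+1})$, with $d$ the exterior differential on $M$. *)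

(* Defs.v *)
From HB Require Import structures.
From mathcomp Require Import all_boot all_order all_algebra.
From mathcomp Require Import all_classical all_reals all_analysis.
From mathcomp Require Import ring.

Set Implicit Arguments.
Unset Strict Implicit.
Unset Printing Implicit Defensive.

Import Order.TTheory GRing.Theory Num.Theory.
Import numFieldNormedType.Exports.

Local Open Scope classical_set_scope.
Local Open Scope ring_scope.

Section Ck.
Context {R : realType} {V W : normedModType R}.

(* Smoothness on an open set [U]: [f] is C^(k+1) when it is differentiable with
   all directional derivatives C^k, i.e. when its differential is C^k. *)
Fixpoint Ck (k : nat) (U : set V) (f : V -> W) : Prop :=
  if k is k'.+1 then
    (forall x, U x -> differentiable f x) /\
    (forall v, Ck k' U (fun x => 'D_v f x))
  else forall x, U x -> {for x, continuous f}.

Definition Cinf (U : set V) (f : V -> W) : Prop := forall k, Ck k U f.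

Lemma near_eq_diff (f g : V -> W) (x : V) :
  (\forall y \near x, f y = g y) -> differentiable f x ->
  differentiable g x /\ 'd g x = 'd f x :> (V -> W).
Proof.
move=> fg df.
have fgx : f x = g x by exact: nbhs_singleton fg.
have dfc : continuous ('d f x) by exact: diff_continuous.
have e : g \o shift x = cst (g x) + 'd f x +o_ 0 id.
  apply/eqaddoP => e e0.
  have /diff_locally/eqaddoP/(_ _ e0) := df.
  have := fg; rewrite (near_shift 0) /= subr0.
  by apply: filterS2 => y /= E; rewrite !fctE /= E fgx.
have dE := diff_unique dfc e.
by split; [apply/(diff_locallyP x g); rewrite dE; split|exact: dE].
Qed.

Lemma near_eq_derive (f g : V -> W) (x v : V) :
  (\forall y \near x, f y = g y) -> differentiable f x -> 'D_v g x = 'D_v f x.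
Proof. by move=> fg df; have [dg E] := near_eq_diff fg df; rewrite (deriveE v df) (deriveE v dg) E. Qed.

Lemma Ck_eq k (U : set V) (f g : V -> W) : open U ->
  {in U, f =1 g} -> Ck k U f -> Ck k U g.
Proof.
move=> oU; have near_U (h1 h2 : V -> W) x : {in U, h1 =1 h2} -> U x ->
    \forall y \near x, h1 y = h2 y.
  move=> h12 Ux; near=> y; apply: h12; rewrite inE; near: y.
  exact: open_nbhs_nbhs.
elim: k f g => [|k IH] f g fg /=.
  move=> fc x Ux; have nfg := near_U _ _ x fg Ux.
  have fx : f @ x --> g x by rewrite -[g x](nbhs_singleton nfg); exact: fc.
  by apply: cvg_trans fx; exact: near_eq_cvg.
move=> [df Df]; split=> [x Ux|v].
  by have [] := near_eq_diff (near_U _ _ x fg Ux) (df x Ux).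
apply: IH (Df v) => x /[!inE] Ux; apply/esym.
by apply: near_eq_derive (df x Ux); exact: near_U.
Unshelve. all: by end_near. Qed.

Lemma Ck_cst k (U : set V) (a : W) : Ck k U (cst a).
Proof.
elim: k a => [|k IH] a /=; first by move=> x _; exact: cvg_cst.
split=> [x _|v]; first exact: (differentiable_cst a x).
have -> : (fun x : V => 'D_v (cst a) x) = cst 0.
  by apply/funext => x; rewrite derive_cst.
exact: IH.
Qed.

Lemma CkP k (U : set V) (f : V -> W) : Ck k.+1 U f -> Ck k U f.
Proof.
elim: k f => [|k IH] f [df Df]; first by move=> x /df; exact: differentiable_continuous.
by split=> // v; apply: IH.
Qed.

Lemma CkD k (U : set V) (f g : V -> W) : open U ->
  Ck k U f -> Ck k U g -> Ck k U (f + g).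
Proof.
move=> oU; elim: k f g => [|k IH] f g /=.
  by move=> fc gc x Ux; apply: continuousD; [exact: fc|exact: gc].
move=> [df Df] [dg Dg]; split=> [x Ux|v].
  by apply: differentiableD; [exact: df|exact: dg].
apply: Ck_eq (IH _ _ (Df v) (Dg v)) => // x /[!inE] Ux.
by rewrite deriveD//; apply: diff_derivable; [exact: df|exact: dg].
Qed.

End Ck.

Lemma CkM {R : realType} {V : normedModType R} k (U : set V) (f g : V -> R) :
  open U -> Ck k U f -> Ck k U g -> Ck k U (f * g).
Proof.
move=> oU; elim: k f g => [|k IH] f g.
  by move=> fc gc x Ux; apply: continuousM; [exact: fc|exact: gc].
move=> Cf Cg; have [[df Df] [dg Dg]] := (Cf, Cg); split=> [x Ux|v].
  by apply: differentiableM; [exact: df|exact: dg].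
have := CkD oU (IH _ _ (CkP Cf) (Dg v)) (IH _ _ (CkP Cg) (Df v)).
apply: Ck_eq => // x /[!inE] Ux.
by rewrite deriveM//; apply: diff_derivable; [exact: df|exact: dg].
Qed.

(* [coord] and [param] are total functions; they are mutually inverse
   homeomorphisms between [dom] and the open set [coord @` dom], and their values
   elsewhere are irrelevant. *)
Record chart (R : realType) (n : nat) (M : topologicalType) := Chart {
  dom : set M;
  coord : M -> 'rV[R]_n;
  param : 'rV[R]_n -> M;
  open_dom : open dom;
  open_im : open (coord @` dom);
  coordK : forall x, dom x -> param (coord x) = x;
  coord_continuous : forall x, dom x -> {for x, continuous coord};
  param_continuous : forall u, (coord @` dom) u -> {for u, continuous param} }.

Arguments open_dom {R n M} c : rename.
Arguments open_im {R n M} c : rename.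

Definition smooth_transition (R : realType) n (M : topologicalType)
    (c d : chart R n M) : Prop :=
  Cinf (coord c @` (dom c `&` dom d)) (coord d \o param c).

Definition compatible (R : realType) n (M : topologicalType)
    (c d : chart R n M) : Prop :=
  smooth_transition c d /\ smooth_transition d c.

Record manifold (R : realType) (n : nat) := Manifold {
  carrier :> topologicalType;
  atlas : set (chart R n carrier);
  manifold_hausdorff : hausdorff_space carrier;
  manifold_second_countable : @second_countable carrier;
  atlas_cover : forall p, exists2 c, atlas c & dom c p;
  atlas_compatible : forall c d, atlas c -> atlas d -> compatible c d }.

(* The charts of [A] form an oriented subatlas of the maximal atlas of [M]. *)
Definition orientable (R : realType) n (M : manifold R n) : Prop :=
  exists A : set (chart R n M),
    [/\ forall c d, A c -> atlas d -> compatible c d,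
        forall p, exists2 c, A c & dom c p
      & forall c d, A c -> A d -> forall p, dom c p -> dom d p ->
          0 < \det ('J (coord d \o param c) (coord c p))].

Section SmoothFunctions.
Context {R : realType} {n : nat} (M : manifold R n).

Definition smooth (f : M -> R) : Prop :=
  forall c, atlas c -> Cinf (coord c @` dom c) (f \o param c).

Definition smoothp (f : M -> R) : bool := `[< smooth f >].

Fact smoothp_cst a : smoothp (cst a).
Proof. by apply/asboolP => c Ac k; exact: Ck_cst. Qed.

Fact smoothpD f g : smoothp f -> smoothp g -> smoothp (f + g).
Proof.
move=> /asboolP sf /asboolP sg; apply/asboolP => c Ac k.
exact: (CkD (open_im c) (sf c Ac k) (sg c Ac k)).
Qed.

Fact smoothpM f g : smoothp f -> smoothp g -> smoothp (f * g).
Proof.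
move=> /asboolP sf /asboolP sg; apply/asboolP => c Ac k.
exact: (CkM (open_im c) (sf c Ac k) (sg c Ac k)).
Qed.

Fact smoothpZ a f : smoothp f -> smoothp (a *: f).
Proof. by move=> sf; have := smoothpM (smoothp_cst a) sf. Qed.

Fact smoothp_subring : GRing.subring_closed smoothp.
Proof.
split=> [|f g sf sg|f g]; [exact: smoothp_cst| |exact: smoothpM].
by apply: smoothpD => //; rewrite -scaleN1r; exact: smoothpZ.
Qed.

Fact smoothp_submod : GRing.subsemimod_closed smoothp.
Proof.
split; last by move=> a f; exact: smoothpZ.
by split; [exact: smoothp_cst|move=> f g; exact: smoothpD].
Qed.

(* The ring C^oo(M). *)
Record Csmooth := MkCsmooth { Cfun :> M -> R; _ : smoothp Cfun }.

HB.instance Definition _ := [isSub for Cfun].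
HB.instance Definition _ := [Choice of Csmooth by <:].
HB.instance Definition _ :=
  @GRing.SubChoice_isSubComPzRing.Build (M -> R) smoothp Csmooth smoothp_subring.
HB.instance Definition _ :=
  @GRing.SubZmodule_isSubLmodule.Build R (M -> R) smoothp Csmooth smoothp_submod.

End SmoothFunctions.

Section VectorFields.
Context {R : realType} {n : nat} (M : manifold R n).
Local Notation C := (Csmooth M).

(* Vector fields are the derivations of C^oo(M): [X f] is the derivative of [f]
   along [X]. *)
Definition derivation (X : C -> C) : Prop :=
  (forall (a : R) f g, X (a *: f + g) = a *: X f + X g) /\
  (forall f g, X (f * g) = f * X g + g * X f).

Definition derivationp (X : C -> C) : bool := `[< derivation X >].

Record vfield := MkVfield { vfun :> C -> C; _ : derivationp vfun }.

HB.instance Definition _ := [isSub for vfun].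
HB.instance Definition _ := [Choice of vfield by <:].

Fact derivationp_zmod : GRing.zmod_closed derivationp.
Proof.
split.
  apply/asboolP; split=> [a f g|f g].
    by rewrite -[RHS]/(a *: 0 + 0 : C) scaler0 addr0.
  by rewrite -[RHS]/(f * 0 + g * 0 : C) !mulr0 addr0.
move=> X Y /asboolP[XL XM] /asboolP[YL YM]; apply/asboolP.
split=> [a f g|f g]; rewrite !fctE.
  by rewrite XL YL scalerBr opprD addrACA.
by rewrite XM YM !mulrBr opprD addrACA.
Qed.

HB.instance Definition _ :=
  @GRing.SubChoice_isSubZmodule.Build (C -> C) derivationp vfield derivationp_zmod.

Lemma vfieldP (X : vfield) : derivation X.
Proof. by case: X => X /= /asboolP. Qed.

Fact scale_derivation (h : C) (X : vfield) : derivationp (fun f => h * X f).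
Proof.
have [XL XM] := vfieldP X; apply/asboolP; split=> [a f g|f g].
  rewrite XL mulrDr; congr (_ + _); apply/val_inj.
  by apply/funext => p /=; rewrite !fctE /= mulrCA.
by rewrite XM mulrDr !(mulrCA h).
Qed.

Definition scale_vfield (h : C) (X : vfield) := MkVfield (scale_derivation h X).

Fact scale_vfieldA h k X :
  scale_vfield h (scale_vfield k X) = scale_vfield (h * k) X.
Proof. by apply/val_inj/funext => f /=; rewrite mulrA. Qed.

Fact scale_vfield1 : left_id 1 scale_vfield.
Proof. by move=> X; apply/val_inj/funext => f /=; rewrite mul1r. Qed.

Fact scale_vfieldDr : right_distributive scale_vfield +%R.
Proof. by move=> h X Y; apply/val_inj/funext => f /=; rewrite !fctE /= mulrDr. Qed.

Fact scale_vfieldDl X : {morph scale_vfield^~ X : h k / h + k}.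
Proof. by move=> h k; apply/val_inj/funext => f /=; rewrite !fctE /= mulrDl. Qed.

HB.instance Definition _ := GRing.Zmodule_isLmodule.Build C vfield
  scale_vfieldA scale_vfield1 scale_vfieldDr scale_vfieldDl.

Fact bracket_derivation (X Y : vfield) :
  derivationp (fun f => X (Y f) - Y (X f)).
Proof.
have [XL XM] := vfieldP X; have [YL YM] := vfieldP Y.
have XD f g : X (f + g) = X f + X g by have := XL 1 f g; rewrite !scale1r.
have YD f g : Y (f + g) = Y f + Y g by have := YL 1 f g; rewrite !scale1r.
apply/asboolP; split=> [a f g|f g].
  by rewrite YL XL XL YL scalerBr opprD addrACA.
rewrite YM XM XD YD !XM !YM.
ring.
Qed.

Definition bracket (X Y : vfield) := MkVfield (bracket_derivation X Y).

End VectorFields.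

Arguments bracket {R n M} X Y.

Section TangentBundle.
Context {R : realType} {n : nat} {M : manifold R n}.
Local Notation C := (Csmooth M).

(* T_p M is the space of derivations at [p] of C^oo(M), inside the space of all
   functions C^oo(M) -> R. *)
Definition tangent (p : M) : set (C -> R) := [set v |
  (forall (a : R) (f g : C), v (a *: f + g) = a * v f + v g) /\
  (forall f g : C, v (f * g) = f p * v g + g p * v f)].

Definition value (X : vfield M) (p : M) : C -> R := fun f => X f p.

(* Local frames are given by global vector fields that form a frame over a
   neighbourhood of the point. Using a bump function, every local section agrees
   near each point with a global one, so this is no restriction. *)
Definition subbundle (k : nat) (H : M -> set (C -> R)) : Prop :=
  forall p : M, exists (U : set M) (e : 'I_k -> vfield M),
    open_nbhs p U /\
    forall q, U q ->
      (forall a : 'I_k -> R,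
         \sum_(i < k) a i *: value (e i) q = 0 -> forall i, a i = 0) /\
      H q = [set v | exists a : 'I_k -> R, v = \sum_(i < k) a i *: value (e i) q].

Definition sections (H : M -> set (C -> R)) : set (vfield M) :=
  [set X | forall p, H p (value X p)].

End TangentBundle.

Section DifferentialForms.
Context {R : realType} {n : nat} {M : manifold R n}.
Local Notation C := (Csmooth M).
Implicit Types X Y Z : vfield M.

(* [d] on 1-forms and 2-forms, and the wedge product of a 1-form with a 2-form,
   without numerical factors: (a /\ b)(X, Y) = a X * b Y - a Y * b X. Forms are
   identified with C^oo(M)-multilinear maps on vector fields. *)
Definition d1 (alpha : vfield M -> C) X Y : C :=
  X (alpha Y) - Y (alpha X) - alpha (bracket X Y).

Definition d2 (omega : vfield M -> vfield M -> C) X Y Z : C :=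
  X (omega Y Z) - Y (omega X Z) + Z (omega X Y)
  - omega (bracket X Y) Z + omega (bracket X Z) Y - omega (bracket Y Z) X.

Definition wedge12 (alpha : vfield M -> C) (beta : vfield M -> vfield M -> C)
    X Y Z : C :=
  alpha X * beta Y Z - alpha Y * beta X Z + alpha Z * beta X Y.

End DifferentialForms.

Section PseudoHermitian.
Context {R : realType} {m : nat} {M : manifold R m.*2.+1}.
Local Notation C := (Csmooth M).
Implicit Types (H : M -> set (C -> R)) (J : vfield M -> vfield M).
Implicit Types (theta : {scalar vfield M}) (T X Y Z V : vfield M).
Implicit Types nabla : vfield M -> vfield M -> vfield M.

(* [J] is only meaningful on sections of [H]; there it is a C^oo(M)-linear map,
   i.e. a bundle endomorphism. *)
Definition CR_structure H J : Prop :=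
  [/\ subbundle m.*2 H,
      forall X, sections H X -> sections H (J X),
      forall (f : C) X Y, sections H X -> sections H Y ->
        J (f *: X + Y) = f *: J X + J Y,
      forall X, sections H X -> J (J X) = - X
    & forall X Y, sections H X -> sections H Y ->
        sections H (bracket (J X) Y + bracket X (J Y)) /\
        bracket X Y - bracket (J X) (J Y)
          + J (bracket (J X) Y + bracket X (J Y)) = 0].

(* The skew form (X, Y) |-> [X, Y] mod H is nondegenerate at every point. *)
Definition contact H : Prop :=
  forall X p, sections H X ->
    (forall Y, sections H Y -> H p (value (bracket X Y) p)) -> value X p = 0.

(* [lam] identifies the line T_p M / H_p with R; choosing between [lam] and
   [- lam] covers the positive and the negative definite case. A linear form on
   T_p M always extends to the ambient space C^oo(M) -> R. *)
Definition strictly_pseudoconvex H J : Prop :=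
  contact H /\
  forall p, exists lam : {scalar (C -> R)},
    (forall v, tangent p v -> (lam v = 0 <-> H p v)) /\
    (forall X, sections H X -> value X p <> 0 ->
       0 < lam (value (- bracket X (J X)) p)).

(* g_theta(X, Y) = 1/2 dtheta(X, JY), for [X] and [Y] sections of [H]. *)
Definition gtheta theta J X Y : C := (2^-1 : R) *: d1 theta X (J Y).

Definition pseudo_hermitian H J theta : Prop :=
  (forall X p, H p (value X p) <-> theta X p = 0) /\
  (forall X p, sections H X -> value X p <> 0 -> 0 < gtheta theta J X X p).

Definition characteristic_vfield theta T : Prop :=
  theta T = 1 /\ forall X, d1 theta T X = 0.

Definition hproj theta T X : vfield M := X - theta X *: T.

Definition flat theta J T V : vfield M -> C :=
  fun X => gtheta theta J V (hproj theta T X).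

Definition linear_connection nabla : Prop :=
  [/\ forall (f : C) X Y Z, nabla (f *: X + Y) Z = f *: nabla X Z + nabla Y Z,
      forall X Y Z, nabla X (Y + Z) = nabla X Y + nabla X Z
    & forall (f : C) X Y, nabla X (f *: Y) = X f *: Y + f *: nabla X Y].

Definition tanaka_webster H J theta T nabla : Prop :=
  [/\ linear_connection nabla,
      (forall X, nabla X T = 0) /\
      (forall X Y, sections H Y -> sections H (nabla X Y)),
      forall X Y Z, sections H Y -> sections H Z ->
        X (gtheta theta J Y Z) = gtheta theta J (nabla X Y) Z + gtheta theta J Y (nabla X Z),
      forall X Y, sections H X -> sections H Y ->
        nabla X Y - nabla Y X = hproj theta T (bracket X Y)
    & forall X, sections H X ->
        nabla T X = ((2^-1 : R) *: (1 : C)) *: (bracket T X - J (bracket T (J X)))].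

Definition curvature nabla X Y Z : vfield M :=
  nabla X (nabla Y Z) - nabla Y (nabla X Z) - nabla (bracket X Y) Z.

(* As in [subbundle], a local frame over [U] is given by global sections of [H];
   the rank of [H] being [m.*2], orthonormality implies that [e] is a frame. *)
Definition orthonormal_frame H J theta (U : set M)
    (e : 'I_m.*2 -> vfield M) : Prop :=
  (forall i, sections H (e i)) /\
  (forall p, U p -> forall i j, gtheta theta J (e i) (e j) p = (i == j)%:R).

Definition is_Ricci H J theta nabla (Ric : vfield M -> vfield M) : Prop :=
  forall X (U : set M) (e : 'I_m.*2 -> vfield M),
    open U -> orthonormal_frame H J theta U e ->
    forall p, U p ->
      value (Ric X) p = value (\sum_l curvature nabla X (e l) (e l)) p.

(* The horizontal projections express that rho_theta vanishes on [T]. The formula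
   determines [rho]. *)
Definition is_Ricci_form H J theta T nabla
    (rho : vfield M -> vfield M -> C) : Prop :=
  forall X Y (U : set M) (e : 'I_m.*2 -> vfield M),
    open U -> orthonormal_frame H J theta U e ->
    forall p, U p ->
      rho X Y p = 2^-1 * \sum_l
        gtheta theta J (curvature nabla (J (e l)) (e l) (hproj theta T X))
          (hproj theta T Y) p.

Definition dW theta T (omega : vfield M -> vfield M -> C) X Y Z : C :=
  d2 omega (hproj theta T X) (hproj theta T Y) (hproj theta T Z).

End PseudoHermitian.

(* Main.v *)
From HB Require Import structures.
Require Import Defs.
From mathcomp Require Import all_boot all_order all_algebra.
From mathcomp Require Import all_classical all_reals all_analysis.
From mathcomp Require Import ring lra.

Set Implicit Arguments.
Unset Strict Implicit.
Unset Printing Implicit Defensive.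

Import Order.TTheory GRing.Theory Num.Theory.
Import numFieldNormedType.Exports.

Local Open Scope classical_set_scope.
Local Open Scope ring_scope.

(* A Chern-Weil argument.  The 2-form [A(X,Y) = tr_H (R(X,Y) o J)] on [TM] is
   closed, by the second Bianchi identity and [nabla J = 0].  The first Bianchi
   identity, with the pseudo-Hermitian torsion [tau X = nabla_T X - [T,X]]
   (symmetric, anticommuting with [J]), shows that [A = 2 rho] on [H] and that
   [A(T,X) = 2 g(J Ric(T), X)].  Hence [2 rho = A - theta /\ A(T,.)], and
   differentiating leaves [- dtheta /\ A(T,.)] on horizontal arguments.  That
   [nabla J = 0] on [H] is the Kaehler computation: [dtheta] is closed and [J] is
   integrable, and together these force [(nabla_X dtheta)(Y,Z) = 0].
   Since [Ric] and [rho] are only specified through local orthonormal frames, such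
   frames, given by global sections, are produced by Gram-Schmidt; normalizing
   globally needs a smooth function equal to [t^(-1/2)] near a point, hence a flat
   function. *)

(** * Smooth functions of one real variable *)

(** The form [rho] traces [R(J e_l, e_l)]: the frame fills the form slots of the curvature, where
    the second Bianchi identity yields no closedness. The closed trace has the free arguments there
    instead. For a Kaehler Levi-Civita connection the two agree by pair symmetry, which torsion
    destroys here; both are therefore reduced separately to one auxiliary contraction, and the
    torsion terms cancel because they are symmetric in the two arguments or because [tau] composed
    with [J] is traceless.

    Vector fields are derivations of the global ring C^oo(M), so an identity valid near a point is
    not differentiated by restricting it: it is multiplied by a function nonzero at the point, and
    the product is differentiated. Accordingly the trace is formed with global fields that are
    orthonormal only near a chosen point; it depends on that point, and its closedness is
    established only there. Identities without derivatives are checked at one point, through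
    functionals that are C^oo(M)-linear over evaluation. *)

Section CkComposition.
Context {R : realType}.

Lemma CkU (V W : normedModType R) k (A B : set V) (f : V -> W) :
  Ck k A f -> Ck k B f -> Ck k (A `|` B) f.
Proof.
elim: k f => [|k IH] f /=; first by move=> fA fB x [/fA|/fB].
move=> [dA DA] [dB DB]; split=> [x [/dA|/dB]//|v].
exact: IH (DA v) (DB v).
Qed.

Lemma Ck_sub (V W : normedModType R) k (A B : set V) (f : V -> W) :
  B `<=` A -> Ck k A f -> Ck k B f.
Proof.
move=> BA; elim: k f => [|k IH] f /=; first by move=> fA x /BA/fA.
by move=> [dA DA]; split=> [x /BA/dA//|v]; exact: IH.
Qed.

Lemma deriveZ1 (f : R -> R) (x v : R) :
  differentiable f x -> 'D_v f x = v * 'D_1 f x.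
Proof.
move=> df; rewrite !deriveE// -[X in 'd f x X]mulr1.
by rewrite -[v * 1]/(v *: (1 : R)) linearZ.
Qed.

Lemma Ck_comp (V : normedModType R) k (U : set V) (A : set R) (f : V -> R)
    (phi : R -> R) :
  open U -> (forall x, U x -> A (f x)) ->
  Ck k A phi -> Ck k U f -> Ck k U (phi \o f).
Proof.
move=> oU; elim: k f phi => [|k IH] f phi UA.
  by move=> phic fc x Ux; apply: continuous_comp; [exact: fc|exact/phic/UA].
move=> Cphi Cf; have [[dphi Dphi] [df Df]] := (Cphi, Cf).
split=> [x Ux|v].
  by apply: differentiable_comp; [exact: df|exact/dphi/UA].
have := CkM oU (Df v) (IH f _ UA (Dphi 1) (CkP Cf)).
apply: Ck_eq => // x /[!inE] Ux.
have dp : differentiable phi (f x) by exact/dphi/UA.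
rewrite [RHS]deriveE; last by apply: differentiable_comp => //; exact: df.
rewrite diff_comp//=; last exact: df.
by rewrite -deriveE// deriveZ1// -deriveE//; exact: df.
Qed.

Lemma Ck_is_derive k (U : set R) (f f' : R -> R) : open U ->
  (forall x, U x -> is_derive x 1 f (f' x)) -> Ck k U f' -> Ck k.+1 U f.
Proof.
move=> oU ff' Cf'; have df x : U x -> differentiable f x.
  by move=> Ux; apply/derivable1_diffP; exact: (@ex_derive _ _ _ _ _ _ _ (ff' _ Ux)).
split=> // v; have := CkM oU (Ck_cst k U v) Cf'.
apply: Ck_eq => // x /[!inE] Ux; rewrite deriveZ1; last exact: df.
by rewrite (@derive_val _ _ _ _ _ _ _ (ff' _ Ux)).
Qed.

Lemma Ck_id k (U : set R) : open U -> Ck k U id.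
Proof.
move=> oU; case: k => [|k]; first by move=> x _; exact: cvg_id.
by apply: Ck_is_derive (Ck_cst k U (1 : R)) => // x Ux; exact: is_derive_id.
Qed.

Let pos : set R := [set x | 0 < x].
Let open_pos : open pos. Proof. exact: open_gt. Qed.

Lemma Ck_inv k : Ck k pos GRing.inv.
Proof.
elim: k => [|k IH]; first by move=> x x0; apply: inv_continuous; rewrite gt_eqF.
have := CkM open_pos (CkM open_pos IH IH) (Ck_cst k pos (-1 : R)).
apply: Ck_is_derive => // x x0.
have x1 : is_derive x 1 id (1 : R) by exact: is_derive_id.
have := @is_deriveV R id x 1 1; rewrite gt_eqF// => /(_ isT x1).
move=> H; apply: (is_derive_eq H).
by rewrite !fctE /= /GRing.scale /= -exprVn; ring.
Qed.

Lemma Ck_sqrt k : Ck k pos Num.sqrt.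
Proof.
elim: k => [|k IH]; first by move=> x x0; exact: sqrt_continuous.
have C2 : Ck k pos ((fun _ => 2) * Num.sqrt) := CkM open_pos (Ck_cst k pos (2 : R)) IH.
have := Ck_comp open_pos _ (Ck_inv k) C2; move=> /(_ _)/Ck_is_derive; apply => //.
  by move=> x x0; rewrite /pos /= fctE mulr_gt0// sqrtr_gt0.
Qed.

(* The functions [x^-n exp(-1/x)] (extended by 0 to [x <= 0]) are closed under
   derivation up to linear combinations. *)
Definition flat_fun n (x : R) : R :=
  if 0 < x then x^-1 ^+ n * expR (- x^-1) else 0.

Lemma flat_fun_ge0 n x : 0 <= flat_fun n x.
Proof.
rewrite /flat_fun; case: ifP => // x0.
by rewrite mulr_ge0 ?expR_ge0// exprn_ge0// invr_ge0 ltW.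
Qed.

(** The exponential series gives [y^(n+1) <= (n+1)! e^y] at [y = 1/x]. Linear decay is what makes
    the functions differentiable at 0. *)
Lemma flat_fun_le n x : flat_fun n x <= n.+1`!%:R * `|x|.
Proof.
rewrite /flat_fun; case: ifP => x0; last by rewrite mulr_ge0.
have y0 : 0 < x^-1 by rewrite invr_gt0.
have := expR_ge1Dxn n (ltW y0); set y := x^-1 in y0 *; move=> ey.
have {}ey : y ^+ n.+1 <= n.+1`!%:R * expR y.
  rewrite -ler_pdivrMl ?ltr0n ?fact_gt0// mulrC.
  by apply: le_trans ey; rewrite lerDr.
rewrite expRN -ler_pdivlMr ?invr_gt0 ?expR_gt0// invrK gtr0_norm//.
rewrite -(ler_pM2r y0) -exprSr mulrAC -(mulrA _ x) divff ?gt_eqF// mulr1.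
exact: ey.
Qed.

Lemma is_derive_flat_fun n (x : R) :
  is_derive x 1 (flat_fun n) (flat_fun n.+2 x - n%:R * flat_fun n.+1 x).
Proof.
have [x0|x0|->] := ltgtP x 0.
- rewrite /flat_fun ltNge (ltW x0) /= mulr0 subr0.
  apply: (@near_eq_is_derive _ _ _ (cst (0 : R))).
  near=> y; rewrite ltNge ltW//=.
  by near: y; exact: lt_nbhsl.
- have xV : is_derive x 1 (@GRing.inv R) (- x ^- 2).
    have x1 : is_derive x 1 id (1 : R) by exact: is_derive_id.
    have := @is_deriveV R id x 1 1; rewrite gt_eqF// => /(_ isT x1) H.
    by apply: (is_derive_eq H); rewrite /GRing.scale /= mulr1.
  have e1 := @is_derive1_comp R expR (fun y => - y^-1) x _ _ (is_derive_expR _)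
    (is_deriveN xV).
  have h1 := is_deriveM (is_deriveX n xV) e1.
  apply: (@near_eq_is_derive _ _ _ (fun y : R => y^-1 ^+ n * expR (- y^-1))).
    near=> y; rewrite /flat_fun; suff -> : 0 < y by [].
    by near: y; exact: lt_nbhsr.
  have -> : (fun y : R => y^-1 ^+ n * expR (- y^-1)) =
    (@GRing.inv R ^+ n) * (expR \o (fun y => - y^-1)).
    by apply/funext => y; rewrite !fctE.
  apply: (is_derive_eq h1); rewrite /flat_fun x0 /GRing.scale /= !fctE /=.
  rewrite -[x ^- 2]exprVn; set y := x^-1; set E := expR _.
  by case: n {h1} => [|n] /=; rewrite !exprS ?expr0; ring.
(* The difference quotient of [flat_fun n] at 0 is exactly [flat_fun n.+1], so the linear bound
   settles the limit. *)
have L : h^-1 *: ((flat_fun n \o shift 0) (h *: (1 : R)) - flat_fun n 0)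
    @[h --> (0 : R)^'] --> (0 : R).
  have b0 : forall h, h^-1 *: ((flat_fun n \o shift 0) (h *: (1 : R)) - flat_fun n 0)
     = flat_fun n.+1 h.
    move=> h; rewrite /flat_fun /= addr0 ltxx subr0 /GRing.scale /= mulr1.
    by case: ifP => h0; rewrite ?mulr0// exprS mulrA.
  under eq_fun do rewrite b0.
  apply/cvgr0Pnorm_lt => e e0; near=> h.
  rewrite ger0_norm ?flat_fun_ge0//; apply: le_lt_trans (flat_fun_le _ _) _.
  rewrite mulrC -ltr_pdivlMr ?ltr0n ?fact_gt0//.
  near: h; apply: dnbhs0_lt; by rewrite divr_gt0// ltr0n fact_gt0.
rewrite {2 3}/flat_fun ltxx mulr0 subr0; apply: DeriveDef.
  by apply/cvg_ex; exists 0.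
exact: cvg_lim.
Unshelve. all: by end_near. Qed.

Lemma Ck_flat_fun n k : Ck k setT (flat_fun n).
Proof.
elim: k n => [|k IH] n.
  move=> x _; apply/differentiable_continuous/derivable1_diffP.
  exact: (@ex_derive _ _ _ _ _ _ _ (is_derive_flat_fun n x)).
have C := CkD openT (IH n.+2) (CkM openT (Ck_cst k setT (- n%:R : R)) (IH n.+1)).
apply: (Ck_is_derive openT _ C) => x _.
by apply: (is_derive_eq (is_derive_flat_fun n x)); rewrite !fctE mulNr.
Qed.

Lemma flat_fun0_gt0 x : (0 < flat_fun 0 x) = (0 < x).
Proof. by rewrite /flat_fun; case: ifP; rewrite ?ltxx// mul1r expR_gt0. Qed.

Lemma flat_fun0_eq0 x : x <= 0 -> flat_fun 0 x = 0.
Proof. by rewrite /flat_fun ltNge => ->. Qed.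

(** The quotient of flat functions is a smooth step, 0 for [t <= 1/4] and 1 for [t >= 1/2]; it
    removes the singularity of [t^(-1/2)] at 0 and leaves the function unchanged from [1/2] on. *)
Definition cutoff_invsqrt (t : R) : R :=
  if 0 < t then flat_fun 0 (4 * t - 1)
    / (flat_fun 0 (4 * t - 1) + flat_fun 0 (2 - 4 * t)) / Num.sqrt t else 0.

Lemma cutoff_invsqrtE t : 2^-1 <= t -> cutoff_invsqrt t ^+ 2 * t = 1.
Proof.
move=> t2; have t0 : 0 < t by lra.
rewrite /cutoff_invsqrt t0 (@flat_fun0_eq0 (2 - _)) ?addr0; last by lra.
rewrite divff; last by rewrite gt_eqF// flat_fun0_gt0; lra.
by rewrite mul1r exprVn sqr_sqrtr ?ltW// mulVf// gt_eqF.
Qed.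

(** Two open sets cover the line: [t > 0], where the formula is built from smooth functions, and
    [t < 1/4], where the function vanishes. *)
Lemma Ck_cutoff_invsqrt k : Ck k setT cutoff_invsqrt.
Proof.
have affC a b : Ck k setT (fun t : R => a * t + b).
  have Ca := CkM openT (Ck_cst k setT a) (Ck_id k openT).
  exact: (CkD openT Ca (Ck_cst k setT b)).
have flatC a b : Ck k setT (fun t : R => flat_fun 0 (a * t + b)).
  exact: (Ck_comp openT _ (Ck_flat_fun 0 k) (affC a b)).
have f1 : Ck k setT (fun t : R => flat_fun 0 (4 * t - 1)) := flatC 4 (- 1).
have f2 : Ck k setT (fun t : R => flat_fun 0 (2 - 4 * t)).
  by have := flatC (- 4) 2; under eq_fun do rewrite mulNr addrC.
pose f3 := (fun t : R => flat_fun 0 (4 * t - 1)) + (fun t : R => flat_fun 0 (2 - 4 * t)).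
have f3C : Ck k setT f3 by exact: (CkD openT f1 f2).
(* The arguments [4 t - 1] and [2 - 4 t] add up to 1, so one of them is positive. *)
have f3_gt0 t : setT t -> pos (f3 t).
  move=> _; rewrite /pos /= /f3 !fctE.
  have [t0|t0] := ltP 0 (4 * t - 1).
    by rewrite ltr_wpDr ?flat_fun_ge0// flat_fun0_gt0.
  by rewrite ltr_wpDl ?flat_fun_ge0// flat_fun0_gt0; lra.
have f4 := CkM openT f1 (Ck_comp openT f3_gt0 (Ck_inv k) f3C).
have f5 : Ck k pos (GRing.inv \o Num.sqrt : R -> R).
  apply: (Ck_comp open_pos _ (Ck_inv k) (Ck_sqrt k)).
  by move=> x x0; rewrite /pos /= sqrtr_gt0.
have A1 : Ck k pos cutoff_invsqrt.
  have := CkM open_pos (Ck_sub (@subsetT _ pos) f4) f5.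
  apply: Ck_eq => // x; rewrite inE => x0.
  by rewrite /cutoff_invsqrt (x0 : 0 < x).
pose B : set R := [set x | x < 4^-1].
have oB : open B by exact: open_lt.
have A2 : Ck k B cutoff_invsqrt.
  apply: Ck_eq oB _ (Ck_cst k B (0 : R)) => x; rewrite inE /B /= => x4.
  rewrite /cutoff_invsqrt; case: ifP => // _.
  by rewrite flat_fun0_eq0 ?mul0r//; lra.
apply: Ck_sub (CkU A1 A2) => x _ /=.
by have [x0|x0] := ltP 0 x; [left|right; apply: le_lt_trans x0 _; lra].
Qed.

End CkComposition.

(** * Functions and vector fields on a manifold *)

Section SmoothManifold.
Context {R : realType} {n : nat} {M : manifold R n}.
Local Notation C := (Csmooth M).
Implicit Types (f g : C) (X Y Z : vfield M) (a : R) (p : M).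

Lemma CsmoothP f : smooth f.
Proof. by case: f => f /= /asboolP. Qed.

Lemma Csmooth_ext f g : (forall p, f p = g p) -> f = g.
Proof. by move=> fg; apply/val_inj/funext. Qed.

Lemma Csmooth_comp (phi : R -> R) f : (forall k, Ck k setT phi) ->
  exists h : C, forall p, h p = phi (f p).
Proof.
move=> Cphi; suff sh : smoothp (phi \o f) by exists (MkCsmooth sh).
apply/asboolP => c Ac k.
exact: (Ck_comp (open_im c) _ (Cphi k) (CsmoothP f Ac k)).
Qed.

Lemma Csmooth_continuous f : continuous (f : M -> R).
Proof.
move=> p; have [c Ac cp] := atlas_cover p.
have np : \forall q \near p, dom c q.
  by apply: open_nbhs_nbhs; split=> //; exact: open_dom.
have fc : {for p, continuous ((f \o param c) \o Defs.coord c)}.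
  apply: continuous_comp; first exact: Defs.coord_continuous.
  by apply: (CsmoothP f Ac 0); exists p.
have E : \forall q \near p, ((f \o param c) \o Defs.coord c) q = f q.
  by apply: filterS np => q cq /=; rewrite Defs.coordK.
have fc' : ((f \o param c) \o Defs.coord c) @ p --> f p.
  by move: fc; rewrite /prop_for /continuous_at (nbhs_singleton E).
by apply: cvg_trans fc'; apply: near_eq_cvg; apply: filterS E.
Qed.

Lemma open_neq0 f : open [set p | f p != 0].
Proof.
rewrite (_ : [set p | _] = (f : M -> R) @^-1` [set x | x != 0]) //.
apply: open_comp; last exact: open_neq.
by move=> p _; exact: Csmooth_continuous.
Qed.

Lemma CfunD f g p : (f + g) p = f p + g p. Proof. by []. Qed.
Lemma CfunN f p : (- f) p = - f p. Proof. by []. Qed.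
Lemma CfunB f g p : (f - g) p = f p - g p. Proof. by []. Qed.
Lemma CfunM f g p : (f * g) p = f p * g p. Proof. by []. Qed.
Lemma CfunZ a f p : (a *: f) p = a * f p. Proof. by []. Qed.
Lemma Cfun0 p : (0 : C) p = 0. Proof. by []. Qed.
Lemma Cfun1 p : (1 : C) p = 1. Proof. by []. Qed.
Lemma Cfun_sum I (r : seq I) (P : pred I) (F : I -> C) p :
  (\sum_(i <- r | P i) F i) p = \sum_(i <- r | P i) F i p.
Proof. by elim/big_rec2 : _ => // i x y _ <-. Qed.
Definition CfunE := (CfunD, CfunN, CfunM, CfunZ, Cfun0, Cfun1, Cfun_sum).

Lemma vfield_ext X Y : (forall f, X f = Y f) -> X = Y.
Proof. by move=> XY; apply/val_inj/funext. Qed.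

Lemma vfDE X Y f : (X + Y) f = X f + Y f. Proof. by []. Qed.
Lemma vfNE X f : (- X) f = - X f. Proof. by []. Qed.
Lemma vf0E f : (0 : vfield M) f = 0. Proof. by []. Qed.
Lemma vfZE g X f : (g *: X) f = g * X f. Proof. by []. Qed.

Lemma vf_addf X f g : X (f + g) = X f + X g.
Proof. by have [XL _] := vfieldP X; have := XL 1 f g; rewrite !scale1r. Qed.

Lemma vf_zerof X : X 0 = 0.
Proof. by apply: (addrI (X 0)); rewrite -vf_addf !addr0. Qed.

Lemma vf_oppf X f : X (- f) = - X f.
Proof. by apply: (addrI (X f)); rewrite -vf_addf !subrr vf_zerof. Qed.

Lemma vf_scalef X a f : X (a *: f) = a *: X f.
Proof.
by have [XL _] := vfieldP X; have := XL a f 0; rewrite !addr0 vf_zerof addr0.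
Qed.

Lemma vf_mulf X f g : X (f * g) = f * X g + g * X f.
Proof. by have [_ XM] := vfieldP X; exact: XM. Qed.

Lemma vf_onef X : X 1 = 0.
Proof.
have := vf_mulf X 1 1; rewrite !mul1r => h.
by apply: (addrI (X 1)); rewrite -h addr0.
Qed.

Lemma vf_sumf X I (r : seq I) (P : pred I) (F : I -> C) :
  X (\sum_(i <- r | P i) F i) = \sum_(i <- r | P i) X (F i).
Proof. by apply: (big_morph _ (vf_addf X) (vf_zerof X)). Qed.

Lemma value_sum I (r : seq I) (P : pred I) (F : I -> vfield M) p :
  value (\sum_(i <- r | P i) F i) p = \sum_(i <- r | P i) value (F i) p.
Proof.
by apply: (big_morph (value^~ p)) => // X Y; apply/funext.
Qed.

Lemma valueB X Y p : value (X - Y) p = value X p - value Y p.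
Proof. by []. Qed.
Lemma valueZ g X p : value (g *: X) p = g p *: value X p.
Proof. by []. Qed.
Lemma valueZR a X p : value ((a *: (1 : C)) *: X) p = a *: value X p.
Proof. by rewrite valueZ CfunE mulr1. Qed.

Lemma vfield_value X Y : (forall p, value X p = value Y p) -> X = Y.
Proof.
move=> XY; apply: vfield_ext => f; apply: Csmooth_ext => p.
by have := congr1 (fun v => v f) (XY p).
Qed.

Lemma bracketE X Y f : bracket X Y f = X (Y f) - Y (X f). Proof. by []. Qed.

Lemma bracketC X Y : bracket X Y = - bracket Y X.
Proof. by apply: vfield_ext => f; rewrite vfNE !bracketE opprB. Qed.

Lemma bracketDr X Y Z : bracket X (Y + Z) = bracket X Y + bracket X Z.
Proof.
apply: vfield_ext => f; rewrite !(vfDE, bracketE) vf_addf; ring.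
Qed.

Lemma bracketDl X Y Z : bracket (X + Y) Z = bracket X Z + bracket Y Z.
Proof. by rewrite bracketC bracketDr opprD -!(bracketC _ Z). Qed.

Lemma bracketNr X Y : bracket X (- Y) = - bracket X Y.
Proof.
by apply: (addrI (bracket X Y)); rewrite -bracketDr !subrr; apply: vfield_ext => f;
  rewrite bracketE !vf0E vf_zerof subrr.
Qed.

Lemma bracketZr X f Y : bracket X (f *: Y) = X f *: Y + f *: bracket X Y.
Proof.
apply: vfield_ext => g; rewrite !(vfDE, vfZE, bracketE) vf_mulf; ring.
Qed.

Lemma bracketZl X f Y : bracket (f *: X) Y = - (Y f *: X) + f *: bracket X Y.
Proof. by rewrite bracketC bracketZr opprD -[- (f *: _)]scalerN -bracketC. Qed.

Lemma jacobi X Y Z : bracket X (bracket Y Z) =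
  bracket (bracket X Y) Z + bracket Y (bracket X Z).
Proof.
apply: vfield_ext => f; rewrite !(vfDE, bracketE) !(vf_addf, vf_oppf); ring.
Qed.

(** Linearity over functions, not just over constants, makes [K] a tensor at [p]: for horizontal
    [X], the number [K X] will depend only on the value of [X] at [p]. *)
Definition pt_linear p (K : vfield M -> R) :=
  forall f X Y, K (f *: X + Y) = f p * K X + K Y.

Section PtLinear.
Variables (p : M) (K : vfield M -> R).
Hypothesis Kl : pt_linear p K.

Lemma pt_linearD X Y : K (X + Y) = K X + K Y.
Proof. by have := Kl 1 X Y; rewrite scale1r mul1r. Qed.
Lemma pt_linear0 : K 0 = 0.
Proof. by apply: (addrI (K 0)); rewrite -pt_linearD !addr0. Qed.
Lemma pt_linearZ f X : K (f *: X) = f p * K X.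
Proof. by have := Kl f X 0; rewrite !(pt_linear0, addr0). Qed.
Lemma pt_linearB X Y : K (X - Y) = K X - K Y.
Proof. by rewrite -scaleN1r pt_linearD pt_linearZ CfunN mulN1r. Qed.
Lemma pt_linear_sum I (s : seq I) (F : I -> vfield M) :
  K (\sum_(i <- s) F i) = \sum_(i <- s) K (F i).
Proof. exact: (big_morph K pt_linearD pt_linear0). Qed.
End PtLinear.

End SmoothManifold.

Ltac vring :=
  apply: vfield_ext => ?; rewrite ?(vfDE, vfNE, vfZE, vf0E); ring.

(** * The 2-form [dtheta] as a tensor *)

Section ExteriorDerivative.
Context {R : realType} {n : nat} {M : manifold R n}.
Local Notation C := (Csmooth M).
Variable theta : {scalar vfield M}.
Implicit Types (f : C) (X Y Z : vfield M).

(** One half as an element of C^oo(M), so that computations stay inside one commutative ring. *)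
Definition Chalf : C := (2^-1 : R) *: (1 : C).

Lemma Chalf_double : Chalf + Chalf = 1.
Proof. by apply: Csmooth_ext => p; rewrite !CfunE; lra. Qed.

Lemma ChalfM f : (2^-1 : R) *: f = Chalf * f.
Proof. by apply: Csmooth_ext => p; rewrite !CfunE mulr1. Qed.

Lemma Cdouble_eq0 f : f + f = 0 -> f = 0.
Proof.
move=> ff; rewrite -[f]mul1r -Chalf_double mulrDl -mulrDr ff mulr0 //.
Qed.

Lemma thetaD X Y : theta (X + Y) = theta X + theta Y.
Proof. exact: linearD. Qed.
Lemma thetaN X : theta (- X) = - theta X.
Proof. exact: linearN. Qed.
Lemma thetaZ f X : theta (f *: X) = f * theta X.
Proof. exact: linearZ. Qed.
Lemma theta0 : theta 0 = 0.
Proof. exact: linear0. Qed.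
Definition thetaE := (thetaD, thetaN, thetaZ, theta0).

(* Locked (as are the tensors below): rewriting with additivity lemmas would
   otherwise see through the definition. *)
Definition dform : vfield M -> vfield M -> C := locked (d1 theta).
Local Notation w := dform.

Lemma dformE X Y : w X Y = X (theta Y) - Y (theta X) - theta (bracket X Y).
Proof. by rewrite /dform -lock. Qed.

Lemma dformC X Y : w X Y = - w Y X.
Proof. rewrite !dformE [bracket X Y]bracketC thetaN; ring. Qed.

Lemma dformDr X Y Z : w X (Y + Z) = w X Y + w X Z.
Proof. by rewrite !dformE bracketDr !(thetaE, vfDE, vf_addf); ring. Qed.

Lemma dformZr X f Y : w X (f *: Y) = f * w X Y.
Proof. by rewrite !dformE bracketZr !(thetaE, vfZE, vf_mulf); ring. Qed.

Lemma dformNr X Y : w X (- Y) = - w X Y.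
Proof. by rewrite -scaleN1r dformZr mulN1r. Qed.

Lemma dformDl X Y Z : w (X + Y) Z = w X Z + w Y Z.
Proof. by rewrite dformC dformDr opprD -!(dformC _ Z). Qed.

Lemma dformZl X f Y : w (f *: X) Y = f * w X Y.
Proof. by rewrite dformC dformZr -mulrN -(dformC _ Y). Qed.

Lemma dformNl X Y : w (- X) Y = - w X Y.
Proof. by rewrite -scaleN1r dformZl mulN1r. Qed.

Definition dform_linE := (dformDr, dformNr, dformZr, dformDl, dformNl, dformZl).

Lemma d2_dform X Y Z : d2 w X Y Z = 0.
Proof.
rewrite /d2 !dformE !(vf_addf, vf_oppf, bracketE).
rewrite (bracketC (bracket Y Z)) (jacobi X Y Z).
rewrite (bracketC Y (bracket X Z)) !thetaE.
ring.
Qed.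

End ExteriorDerivative.

(** * Tensoriality and local orthonormal frames *)

(** Points are chosen one at a time. While fewer than [n] are chosen, a nonzero row [c] kills all
    their columns; freeness gives a point [t] whose column [c] does not kill, so this column is
    independent of the others and raises the rank. *)
Lemma exists_dual_points (F : fieldType) (n : nat) (S : Type) (v : 'I_n -> S -> F) :
  (forall a : 'rV[F]_n, (forall t, \sum_i a 0 i * v i t = 0) -> a = 0) ->
  exists u : 'I_n -> S, \det (\matrix_(i, j) v i (u j)) != 0.
Proof.
move=> vfree.
have H k : (k <= n)%N -> exists u : 'I_k -> S,
    \rank (\matrix_(i < n, j < k) v i (u j)) = k.
  elim: k => [|k IH] kn.
    by exists (fun i : 'I_0 => False_rect S (notF (ltn_ord i))); apply/eqP; rewrite -leqn0 rank_leq_col.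
  have [u rk] := IH (ltnW kn); set A := \matrix_(_, _) _ in rk.
  have [c c0 cA] : exists2 c : 'rV_n, c != 0 & c *m A = 0.
    have : kermx A != 0.
      by rewrite -mxrank_eq0 mxrank_ker rk subn_eq0 -ltnNge.
    move=> /rowV0Pn[c cK c0]; exists c => //.
    by apply/sub_kermxP.
  have [t ct] : exists t, \sum_i c 0 i * v i t != 0.
    apply: contrapT => h; move/eqP: c0; apply; apply: vfree => t.
    by apply: contrapT => /eqP ct; apply: h; exists t.
  pose w := fun i : 'I_(k + 1) => match fintype.split i with inl j => u j | inr _ => t end.
  suff : (k < \rank (\matrix_(i < n, j < k + 1) v i (w j)))%N.
    rewrite -addn1 => kw; exists w; apply/eqP.
    by rewrite eqn_leq rank_leq_col.
  set B := \matrix_(i < n, j < k + 1) _.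
  have BE : B = row_mx A (\col_i v i t).
    apply/matrixP => i j; rewrite mxE /w mxE.
    by case: fintype.split => l; rewrite mxE.
  have AB : (A^T < B^T)%MS.
    rewrite ltmxE BE tr_row_mx; apply/andP; split.
      by have := submx_refl (col_mx A^T (\col_i v i t)^T); rewrite col_mx_sub => /andP[].
    apply/negP; rewrite col_mx_sub => /andP[_ /submxP[d dE]].
    move/eqP: ct; apply.
    have : c *m (\col_i v i t) = 0.
      apply: trmx_inj; rewrite trmx_mul dE -mulmxA -trmx_mul cA trmx0 mulmx0 trmx0 //.
    move=> /matrixP/(_ 0 0); rewrite !mxE => cv0; rewrite -[RHS]cv0.
    by apply: eq_bigr => i _; rewrite mxE.
  by move: AB; rewrite ltmxErank !mxrank_tr rk => /andP[].
have [u ru] := H n (leqnn n); exists u.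
by rewrite -unitfE -[_ \is a _]unitmxE -row_full_unit; apply/eqP; exact: ru.
Qed.

Section Frames.
Context {R : realType} {m : nat} {M : manifold R m.*2.+1}.
Local Notation C := (Csmooth M).
Local Notation n := m.*2.
Variables (H : M -> set (C -> R)) (theta : {scalar vfield M}) (T : vfield M).
Variable g : vfield M -> vfield M -> C.
Implicit Types (f : C) (X Y Z : vfield M) (p q r : M).

Hypothesis H_subbundle : subbundle n H.
Hypothesis HE : forall X p, H p (value X p) <-> theta X p = 0.
Hypothesis thetaT : theta T = 1.
Hypothesis gC : forall X Y, g X Y = g Y X.
Hypothesis g_linear : forall f X Y Z, g (f *: X + Y) Z = f * g X Z + g Y Z.
Hypothesis g_gt0 : forall X p, theta X = 0 -> value X p <> 0 -> 0 < g X X p.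

Lemma g_addl X Y Z : g (X + Y) Z = g X Z + g Y Z.
Proof. by have := g_linear 1 X Y Z; rewrite scale1r mul1r. Qed.
Lemma g_0l Z : g 0 Z = 0.
Proof. by apply: (addrI (g 0 Z)); rewrite -g_addl !addr0. Qed.
Lemma g_scalel f X Z : g (f *: X) Z = f * g X Z.
Proof. by have := g_linear f X 0 Z; rewrite g_0l !addr0. Qed.
Lemma g_suml I (s : seq I) (F : I -> vfield M) Z :
  g (\sum_(i <- s) F i) Z = \sum_(i <- s) g (F i) Z.
Proof. by apply: (big_morph (g^~ Z)) => [X Y|]; [exact: g_addl|exact: g_0l]. Qed.

Lemma pt_linear_g p Y : pt_linear p (fun X => g X Y p).
Proof. by move=> f X Z; rewrite g_linear. Qed.

(** Evaluation is made a ring morphism so that it commutes with determinants and adjugates. *)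
Definition Ceval p (f : C) : R := f p.
HB.instance Definition _ p := GRing.isZmodMorphism.Build C R (Ceval p)
  (fun f h : C => erefl).
HB.instance Definition _ p := GRing.isMonoidMorphism.Build C R (Ceval p)
  (conj erefl (fun f h : C => erefl)).

Definition cst_comb k (a : 'I_k -> R) (F : 'I_k -> vfield M) : vfield M :=
  \sum_i (a i *: (1 : C)) *: F i.

Lemma value_cst_comb k (a : 'I_k -> R) F p :
  value (cst_comb a F) p = \sum_i a i *: value (F i) p.
Proof. by rewrite value_sum; apply: eq_bigr => i _; rewrite valueZR. Qed.

Lemma pt_linear_cst_comb p K k (a : 'I_k -> R) F : pt_linear p K ->
  K (cst_comb a F) = \sum_i a i * K (F i).
Proof.
move=> Kl; rewrite (pt_linear_sum Kl); apply: eq_bigr => i _.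
by rewrite (pt_linearZ Kl) CfunZ Cfun1 mulr1.
Qed.

Lemma theta_comb k (a : 'I_k -> C) (F : 'I_k -> vfield M) :
  (forall i, theta (F i) = 0) -> theta (\sum_i a i *: F i) = 0.
Proof.
move=> hF; rewrite linear_sum big1// => i _.
by rewrite linearZ /= hF; exact: mulr0.
Qed.

(** A dimension count: the matrix [B] of [F] in the frame given by [H_subbundle] has independent
    rows and is square, hence invertible. *)
Lemma hor_spanned r (F : 'I_n -> vfield M) : (forall i, theta (F i) = 0) ->
  (forall a : 'I_n -> R, \sum_i a i *: value (F i) r = 0 -> forall i, a i = 0) ->
  forall X, theta X = 0 -> exists a : 'I_n -> R, value X r = \sum_i a i *: value (F i) r.
Proof.
move=> hF Ffree X hX; have [U [h [[_ Ur] /(_ _ Ur)[hfree Hr]]]] := H_subbundle r.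
have span Y : theta Y = 0 -> exists a : 'I_n -> R, value Y r = \sum_i a i *: value (h i) r.
  move=> hY; have : H r (value Y r) by apply/HE; rewrite hY.
  by rewrite Hr.
have /choice[A AE] := fun i => span _ (hF i).
have [x xE] := span X hX.
pose B := \matrix_(i, j) A i j.
have BE (a : 'rV_n) : \sum_i a 0 i *: value (F i) r = \sum_j (a *m B) 0 j *: value (h j) r.
  under eq_bigr => i _ do rewrite AE scaler_sumr.
  rewrite exchange_big; apply: eq_bigr => j _; rewrite mxE scaler_suml.
  by apply: eq_bigr => i _; rewrite mxE scalerA.
have Bu : B \in unitmx.
  rewrite -row_free_unit; apply: inj_row_free => a aB; apply/rowP => i.
  rewrite mxE; apply: (Ffree (fun i => a 0 i)).
  by rewrite BE aB big1// => j _; rewrite mxE scale0r.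
exists (fun i => (\row_j x j *m invmx B) 0 i); rewrite BE mulmxKV// xE.
by apply: eq_bigr => j _; rewrite mxE.
Qed.

(* A frame near [q] for which no cut-off is needed: multiplying twice by the
   determinant [D] of [F i (u j)] makes Cramer's formula valid on all of [M]. *)
Lemma cramer_frame q : exists (F : 'I_n -> vfield M) (D : C),
  [/\ forall i, theta (F i) = 0,
      forall a : 'I_n -> R, \sum_i a i *: value (F i) q = 0 -> forall i, a i = 0,
      D q != 0
    & forall X, theta X = 0 -> exists2 c : 'I_n -> C,
        D *: X = \sum_i c i *: F i & value X q = 0 -> forall i, c i q = 0].
Proof.
have [U [h [[_ Uq] /(_ _ Uq)[hfree Hq]]]] := H_subbundle q.
(* The fields [h i] are horizontal only over [U]. Projecting them makes them horizontal on all of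
   [M] and keeps their values at [q]. *)
pose F i := hproj theta T (h i).
have hF i : theta (F i) = 0.
  by rewrite /F /hproj linearB linearZ /= thetaT; apply/eqP; rewrite subr_eq0; apply/eqP/esym/mulr1.
have Fq i : value (F i) q = value (h i) q.
  rewrite /F /hproj valueB valueZ.
  have -> : theta (h i) q = 0.
    apply/HE; rewrite Hq; exists (fun j => (j == i)%:R).
    rewrite (bigD1 i)//= eqxx scale1r big1 ?addr0// => j /negPf ->.
    by rewrite scale0r.
  by rewrite scale0r subr0.
have Ffree (a : 'I_n -> R) : \sum_i a i *: value (F i) q = 0 -> forall i, a i = 0.
  by move=> Fa; apply: hfree; apply: etrans Fa; apply: eq_bigr => i _; rewrite Fq.
(* Tangent vectors are functions on C^oo(M), so independent ones are separated by finitely many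
   functions [u j], which act as partial coordinates. *)
have [u du] : exists u : 'I_n -> C, \det (\matrix_(i, j) value (F i) q (u j)) != 0.
  apply: (@exists_dual_points _ _ _ (fun i => value (F i) q)) => a Fa; apply/rowP => i; rewrite mxE.
  apply: (Ffree (fun i => a 0 i)); apply/funext => f.
  by rewrite fct_sumE; exact: Fa f.
pose G := \matrix_(i, j) F i (u j) : 'M[C]_n.
pose D := \det G.
have Dr r : D r = \det (\matrix_(i, j) value (F i) r (u j)).
  rewrite -[D r]/(Ceval r (\det G)) -det_map_mx; congr (\det _).
  by apply/matrixP => i j; rewrite !mxE.
exists F, (D * D); split=> //.
  by rewrite CfunM mulf_neq0// Dr.
move=> X hX; exists (fun i => D * \sum_j X (u j) * (\adj G) j i); last first.
  move=> X0 i; rewrite CfunM [X in _ * X](_ : _ = 0) ?mulr0// Cfun_sum.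
  apply: big1 => j _; rewrite CfunM -[X (u j) q]/(value X q (u j)) X0.
  exact: mul0r.
apply: vfield_value => r; rewrite value_sum valueZ.
under eq_bigr => i _ do rewrite valueZ CfunM -scalerA.
rewrite -scaler_sumr CfunM -scalerA.
(* Where [F] may fail to be a frame, the second factor [D] makes both sides vanish. *)
have [->|Dr0] := eqVneq (D r) 0; first by rewrite !scale0r.
congr (_ *: _); set Gr := \matrix_(i, j) value (F i) r (u j) in (Dr).
have Gu : Gr \in unitmx by rewrite unitmxE unitfE -Dr.
have [a aE] : exists a : 'I_n -> R, value X r = \sum_i a i *: value (F i) r.
  apply: hor_spanned => // a aF i.
  have aG : \row_i a i *m Gr = 0.
    apply/rowP => j; have := congr1 (fun v => v (u j)) aF.
    rewrite fct_sumE !mxE => aFj; apply: etrans aFj.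
    by apply: eq_bigr => l _; rewrite !mxE.
  have := congr1 (mulmx^~ (invmx Gr)) aG; rewrite mulmxK// mul0mx.
  by move=> /rowP/(_ i); rewrite !mxE.
have XG : \row_j X (u j) r = \row_i a i *m Gr.
  apply/rowP => j; rewrite !mxE -[LHS]/(value X r (u j)) aE fct_sumE.
  by apply: eq_bigr => l _; rewrite !mxE.
rewrite aE scaler_sumr; apply: eq_bigr => i _; rewrite scalerA; congr (_ *: _).
have GrE : Gr = map_mx (Ceval r) G by apply/matrixP => k l; rewrite !mxE.
have := congr1 (mulmx^~ (\adj Gr)) XG; rewrite -mulmxA mul_mx_adj -Dr.
rewrite GrE -map_mx_adj; set E := \adj G.
move=> /rowP/(_ i); rewrite mul_mx_scalar !mxE => <-.
by rewrite Cfun_sum; apply: eq_bigr => j _; rewrite CfunM !mxE.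
Qed.

(** After multiplication by [D], nonzero at [p], the field is a global combination of frame fields
    with coefficients vanishing at [p]. *)
Lemma pt_linear_eq0 p K X : pt_linear p K -> theta X = 0 -> value X p = 0 -> K X = 0.
Proof.
move=> Kl hX X0; have [F [D [_ _ Dp FE]]] := cramer_frame p.
have [c cE /(_ X0) c0] := FE X hX.
apply: (mulfI Dp); rewrite -(pt_linearZ Kl) cE (pt_linear_sum Kl) mulr0.
by rewrite big1// => i _; rewrite (pt_linearZ Kl) c0 mul0r.
Qed.

(** By tensoriality [X] may be replaced by the combination of the [e i] with constant coefficients
    that has the same value at [q]; [g] then reads off the coefficients. *)
Lemma orthonormal_expand q (e : 'I_n -> vfield M) :
  (forall i, theta (e i) = 0) ->
  (forall i j, g (e i) (e j) q = (i == j)%:R) ->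
  forall K X, pt_linear q K -> theta X = 0 ->
  K X = \sum_l g X (e l) q * K (e l).
Proof.
move=> he eo.
have hcomb (a : 'I_n -> R) : theta (cst_comb a e) = 0 by exact: theta_comb.
have gcomb (a : 'I_n -> R) k : g (cst_comb a e) (e k) q = a k.
  rewrite (pt_linear_cst_comb a e (pt_linear_g q (e k))) (bigD1 k)//= eo eqxx mulr1.
  by rewrite big1 ?addr0// => i /negPf ik; rewrite eo ik mulr0.
have efree (a : 'I_n -> R) : \sum_i a i *: value (e i) q = 0 -> forall i, a i = 0.
  rewrite -value_cst_comb => a0 i; rewrite -gcomb.
  exact: (pt_linear_eq0 (pt_linear_g q (e i))).
move=> K X Kl hX; have [a aE] := hor_spanned he efree hX.
have KE K' : pt_linear q K' -> K' X = \sum_i a i * K' (e i).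
  move=> K'l; rewrite -(pt_linear_cst_comb a e K'l); apply/eqP.
  rewrite -subr_eq0 -(pt_linearB K'l); apply/eqP/(pt_linear_eq0 K'l).
    by rewrite linearB /= hX hcomb subrr.
  by rewrite valueB value_cst_comb aE subrr.
rewrite (KE K Kl); apply: eq_bigr => i _; congr (_ * _).
rewrite (KE _ (pt_linear_g q (e i))) (bigD1 i)//= eo eqxx mulr1.
by rewrite big1 ?addr0// => j /negPf ij; rewrite eo ij mulr0.
Qed.

(* [b] is a bump function at [q]: equalities near [q] are expressed by multiplying
   with [b], which makes them global and stable under derivations. *)
Lemma normalize_near q X : theta X = 0 -> value X q <> 0 ->
  exists h b : C, b q != 0 /\ b * (g (h *: X) (h *: X) - 1) = 0.
Proof.
move=> hX Xq; have t0 := g_gt0 hX Xq; set t := g X X q in t0.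
(* Rescaled so that [s q = 1]: the cut-off equals [s^(-1/2)] where [s >= 1/2], and [b] is positive
   exactly where [s > 1/2]. *)
pose s : C := t^-1 *: g X X.
have [k kE] := Csmooth_comp s (@Ck_cutoff_invsqrt R).
have [b bE] := Csmooth_comp (2 *: s - 1) (Ck_flat_fun 0).
have sq : s q = 1 by rewrite CfunZ mulVf// gt_eqF.
exists ((Num.sqrt t)^-1 *: k), b; split.
  rewrite bE CfunB CfunZ sq Cfun1 gt_eqF// flat_fun0_gt0.
  by rewrite mulr1 subr_gt0 ltr1n.
apply: Csmooth_ext => p.
rewrite g_scalel gC g_scalel !(CfunM, CfunB, CfunZ, Cfun1, Cfun0) bE kE CfunB CfunZ Cfun1.
have -> : (Num.sqrt t)^-1 * cutoff_invsqrt (s p)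
    * ((Num.sqrt t)^-1 * cutoff_invsqrt (s p) * g X X p)
    = cutoff_invsqrt (s p) ^+ 2 * s p.
  have <- : (Num.sqrt t)^-1 * (Num.sqrt t)^-1 * g X X p = s p.
    by rewrite CfunZ -expr2 exprVn sqr_sqrtr ?ltW.
  by ring.
have [sp|sp] := leP 2^-1 (s p).
  by rewrite cutoff_invsqrtE// subrr mulr0.
rewrite flat_fun0_eq0 ?mul0r//.
by rewrite subr_le0 -ler_pdivlMl// mulr1 ltW.
Qed.

(** At stage [k < n] some residual [Y i] is nonzero at [q], since otherwise the [n] independent
    vectors [F i] would lie there in the span of [k] vectors. That residual, whichever it is, gets
    normalized. The factor [b] accumulates the bump functions of all stages. *)
Lemma gram_schmidt q : exists (e : 'I_n -> vfield M) (b : C),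
  [/\ forall i, theta (e i) = 0, b q != 0
    & forall i j, b * (g (e i) (e j) - (i == j)%:R) = 0].
Proof.
have [F [_ [hF Ffree _ _]]] := cramer_frame q.
suff /(_ n (leqnn n))[e [b [he bq eo]]] : forall k, (k <= n)%N ->
    exists (e : nat -> vfield M) (b : C), [/\ forall i, theta (e i) = 0, b q != 0
    & forall i j, (i < k)%N -> (j < k)%N -> b * (g (e i) (e j) - (i == j)%:R) = 0].
  by exists (fun i => e i), b; split=> // i j; exact: eo.
elim=> [|k IH] kn.
  by exists (fun=> 0), 1; split=> //; [move=> i; exact: linear0|rewrite Cfun1 oner_neq0].
have [e [b [he bq eo]]] := IH (ltnW kn).
pose Y i := F i - \sum_(j < k) g (F i) (e j) *: e j.
have hY i : theta (Y i) = 0.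
  rewrite linearB /= hF theta_comb ?subr0// => j; exact: he.
have [i Yi] : exists i, value (Y i) q <> 0.
  apply: contrapT => nY.
  have {nY} Y0 i : value (Y i) q = 0 by apply: contrapT => Yi; apply: nY; exists i.
  have FE i : value (F i) q = \sum_(j < k) g (F i) (e j) q *: value (e j) q.
    have := Y0 i; rewrite valueB value_sum => /eqP; rewrite subr_eq0 => /eqP ->.
    by apply: eq_bigr => j _; rewrite valueZ.
  pose A := \matrix_(i < n, j < k) g (F i) (e j) q.
  have : row_free A.
    apply: inj_row_free => c cA; apply/rowP => l; rewrite mxE.
    apply: (Ffree (fun i => c 0 i)).
    under eq_bigr => i' _ do rewrite FE scaler_sumr.
    rewrite exchange_big big1// => j _.
    have : \sum_i' (c 0 i' * g (F i') (e j) q) = 0.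
      move/rowP: cA => /(_ j); rewrite !mxE => cAj; apply: etrans cAj.
      by apply: eq_bigr => i' _; rewrite mxE.
    under eq_bigr => i' _ do rewrite scalerA.
    by rewrite -scaler_suml => ->; rewrite scale0r.
  rewrite /row_free => /eqP rA; have := rank_leq_col A; rewrite rA leqNgt kn //.
have [h [c [cq hc]]] := normalize_near (hY i) Yi.
have eY j : (j < k)%N -> b * g (Y i) (e j) = 0.
  move=> jk; rewrite /Y g_addl -scaleN1r g_scalel g_suml mulN1r mulrBr mulr_sumr.
  rewrite (bigD1 (Ordinal jk))//= big1 => [|l /eqP lj].
    rewrite addr0 g_scalel mulrCA.
    have := eo _ _ jk jk; rewrite eqxx mulrBr mulr1 => /eqP.
    by rewrite subr_eq0 => /eqP ->; rewrite mulrC subrr.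
  rewrite g_scalel mulrCA.
  have := eo _ _ (ltn_ord l) jk; rewrite (_ : (l == j :> nat) = false) ?subr0.
    by move=> ->; rewrite mulr0.
  by apply/eqP => lj'; apply: lj; exact/val_inj.
pose e' l := if l == k then h *: Y i else e l.
exists e', (b * c); split.
- by move=> l; rewrite /e'; case: eqP => // _; rewrite linearZ /= hY; exact: mulr0.
- by rewrite CfunM mulf_neq0.
- have ek l : (l < k)%N -> b * c * g (h *: Y i) (e l) = 0.
    move=> /eY lk; rewrite g_scalel.
    transitivity (c * h * (b * g (Y i) (e l))); first by ring.
    by rewrite lk mulr0.
  move=> l1 l2; rewrite !ltnS (leq_eqVlt l1) (leq_eqVlt l2) /e'.
  case: (l1 =P k) => [->|n1] /= l1k; case: (l2 =P k) => [->|n2] /= l2k.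
  + by rewrite eqxx -mulrA hc mulr0.
  + rewrite (_ : (k == l2) = false) ?subr0 ?ek//.
    by apply/eqP => e0; apply: n2.
  + rewrite (_ : (l1 == k) = false) ?subr0 1?gC ?ek//.
    by apply/eqP.
  + by rewrite mulrAC eo// mul0r.
Qed.

End Frames.

(** * The Tanaka-Webster connection *)

Section TanakaWebster.
Context {R : realType} {m : nat} {M : manifold R m.*2.+1}.
Local Notation C := (Csmooth M).
Variables (theta : {scalar vfield M}) (T : vfield M).
Variables (J : vfield M -> vfield M) (nabla : vfield M -> vfield M -> vfield M).
Implicit Types (f : C) (X Y Z V W : vfield M).
Local Notation w := (dform theta).
Local Notation hp := (hproj theta T).
Local Notation Chalf := (@Chalf R m.*2.+1 M).

(** For a [J] with [J T = 0], this is the pullback of g_theta along the projection to [H]: bilinear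
    on all vector fields and degenerate along [T]. *)
Definition metric : vfield M -> vfield M -> C :=
  locked (fun X Y => Chalf * w X (J Y)).
Local Notation g := metric.

Hypothesis thetaT : theta T = 1.
Hypothesis wT : forall X, w T X = 0.
Hypothesis J_linear : forall f X Y, J (f *: X + Y) = f *: J X + J Y.
Hypothesis thetaJ : forall X, theta (J X) = 0.
Hypothesis JJ : forall X, J (J X) = - hp X.
Hypothesis J_integrable1 : forall X Y, theta X = 0 -> theta Y = 0 ->
  theta (bracket (J X) Y + bracket X (J Y)) = 0.
Hypothesis J_integrable2 : forall X Y, theta X = 0 -> theta Y = 0 ->
  bracket X Y - bracket (J X) (J Y)
  + J (bracket (J X) Y + bracket X (J Y)) = 0.
Hypothesis metric_nondegenerate : forall X, theta X = 0 ->
  (forall Y, theta Y = 0 -> g X Y = 0) -> X = 0.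
Hypothesis nabla_connection : linear_connection nabla.
Hypothesis nablaT : forall X, nabla X T = 0.
Hypothesis nabla_hor : forall X Y, theta Y = 0 -> theta (nabla X Y) = 0.
Hypothesis nabla_metric_hor : forall X Y Z, theta Y = 0 -> theta Z = 0 ->
  X (g Y Z) = g (nabla X Y) Z + g Y (nabla X Z).
Hypothesis nabla_torsion : forall X Y, theta X = 0 -> theta Y = 0 ->
  nabla X Y - nabla Y X = hp (bracket X Y).
Hypothesis nabla_charE : forall X, theta X = 0 ->
  nabla T X = Chalf *: (bracket T X - J (bracket T (J X))).

Lemma metricE X Y : g X Y = Chalf * w X (J Y).
Proof. by rewrite /metric -lock. Qed.

Lemma JD X Y : J (X + Y) = J X + J Y.
Proof. by have := J_linear 1 X Y; rewrite !scale1r. Qed.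
Lemma J0 : J 0 = 0.
Proof. by apply: (addrI (J 0)); rewrite -JD !addr0. Qed.
Lemma JZ f X : J (f *: X) = f *: J X.
Proof. by have := J_linear f X 0; rewrite J0 !addr0. Qed.
Lemma JN X : J (- X) = - J X.
Proof. by rewrite -scaleN1r JZ scaleN1r. Qed.
Definition JE := (JD, JN, JZ, J0).

Lemma hprojE X : hp X = X - theta X *: T. Proof. by []. Qed.
Lemma hproj_id X : theta X = 0 -> hp X = X.
Proof. by rewrite hprojE => ->; rewrite scale0r subr0. Qed.
Lemma theta_hproj X : theta (hp X) = 0.
Proof. by rewrite hprojE !(thetaE theta) thetaT mulr1 subrr. Qed.
Lemma hproj_split X : X = hp X + theta X *: T.
Proof. by rewrite hprojE subrK. Qed.

Lemma JT : J T = 0.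
Proof.
have JJT : J (J T) = 0 by rewrite JJ hprojE thetaT scale1r subrr oppr0.
by have := JJ (J T); rewrite JJT J0 hproj_id// => /esym/eqP; rewrite oppr_eq0 => /eqP.
Qed.

Lemma J_hproj X : J (hp X) = J X.
Proof. by rewrite hprojE !JE JT scaler0 oppr0 addr0. Qed.

Lemma dformTr X : w X T = 0.
Proof. by rewrite dformC wT oppr0. Qed.
Lemma dform_hprojr X Y : w X (hp Y) = w X Y.
Proof. by rewrite hprojE !dform_linE dformTr mulr0 oppr0 addr0. Qed.
Lemma dform_hprojl X Y : w (hp X) Y = w X Y.
Proof. by rewrite dformC dform_hprojr -dformC. Qed.

Lemma dform_hor X Y : theta X = 0 -> theta Y = 0 -> w X Y = - theta (bracket X Y).
Proof. by move=> hX hY; rewrite !dformE hX hY !vf_zerof subr0 sub0r. Qed.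

(** The first integrability condition at [(X, J Y)] says that [[J X, J Y] - [X, Y]] is horizontal,
    and on horizontal fields [dtheta] is minus [theta] of the bracket. Symmetry of [g] follows. *)
Lemma dformJJ X Y : w (J X) (J Y) = w X Y.
Proof.
rewrite -[RHS]dform_hprojl -[RHS]dform_hprojr -[J X]J_hproj -[J Y]J_hproj.
have := J_integrable1 (theta_hproj X) (thetaJ (hp Y)).
rewrite (dform_hor (thetaJ _) (thetaJ _)) (dform_hor (theta_hproj _) (theta_hproj _)).
rewrite JJ (hproj_id (theta_hproj Y)) bracketNr thetaE thetaN => /eqP.
by rewrite subr_eq0 => /eqP ->.
Qed.

Lemma dformJ X Y : w X (J Y) = - w (J X) Y.
Proof. by rewrite -dformJJ JJ dformNr dform_hprojr. Qed.

Lemma metricC X Y : g X Y = g Y X.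
Proof. by rewrite !metricE dformJ -dformC. Qed.

Lemma metricJ X Y : g (J X) Y = - g X (J Y).
Proof. by rewrite !metricE dformJJ JJ dformNr dform_hprojr mulrN opprK. Qed.

Lemma metricDl X Y Z : g (X + Y) Z = g X Z + g Y Z.
Proof. by rewrite !metricE dformDl mulrDr. Qed.
Lemma metricNl X Y : g (- X) Y = - g X Y.
Proof. by rewrite !metricE dformNl mulrN. Qed.
Lemma metricZl f X Y : g (f *: X) Y = f * g X Y.
Proof. by rewrite !metricE dformZl mulrCA. Qed.
Lemma metricDr X Y Z : g X (Y + Z) = g X Y + g X Z.
Proof. by rewrite metricC metricDl !(metricC X). Qed.
Lemma metricNr X Y : g X (- Y) = - g X Y.
Proof. by rewrite metricC metricNl (metricC X). Qed.
Lemma metricZr f X Y : g X (f *: Y) = f * g X Y.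
Proof. by rewrite metricC metricZl (metricC X). Qed.
Definition metric_linE := (metricDl, metricNl, metricZl, metricDr, metricNr, metricZr).

Lemma metric_hprojl X Y : g (hp X) Y = g X Y. Proof. by rewrite !metricE dform_hprojl. Qed.
Lemma metric_hprojr X Y : g X (hp Y) = g X Y. Proof. by rewrite metricC metric_hprojl metricC. Qed.

Lemma dform_metric X Y : w X Y = - (g X (J Y) + g X (J Y)).
Proof.
by rewrite !metricE JJ dformNr dform_hprojr -mulrDl Chalf_double mul1r opprK.
Qed.

Lemma metric_eq0 X : theta X = 0 -> (forall Y, g Y X = 0) -> X = 0.
Proof. by move=> hX gX; apply: metric_nondegenerate => // Y _; rewrite metricC. Qed.

Lemma nablaDl X Y Z : nabla (X + Y) Z = nabla X Z + nabla Y Z.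
Proof. by have [nl _ _] := nabla_connection; have := nl 1 X Y Z; rewrite !scale1r. Qed.
Lemma nablaDr X Y Z : nabla X (Y + Z) = nabla X Y + nabla X Z.
Proof. by have [_ nr _] := nabla_connection. Qed.
Lemma nablaZr X f Y : nabla X (f *: Y) = X f *: Y + f *: nabla X Y.
Proof. by have [_ _ nl] := nabla_connection. Qed.
Lemma nabla0l Z : nabla 0 Z = 0.
Proof. by apply: (addrI (nabla 0 Z)); rewrite -nablaDl !addr0. Qed.
Lemma nablaZl f X Z : nabla (f *: X) Z = f *: nabla X Z.
Proof. by have [nl _ _] := nabla_connection; have := nl f X 0 Z; rewrite !(nabla0l, addr0). Qed.
Lemma nablaNl X Z : nabla (- X) Z = - nabla X Z.
Proof. by rewrite -scaleN1r nablaZl scaleN1r. Qed.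
Lemma nabla0r X : nabla X 0 = 0.
Proof. by apply: (addrI (nabla X 0)); rewrite -nablaDr !addr0. Qed.
Lemma nablaNr X Y : nabla X (- Y) = - nabla X Y.
Proof. by apply: (addrI (nabla X Y)); rewrite -nablaDr !subrr nabla0r. Qed.
Definition nabla_linE := (nablaDl, nablaNl, nablaDr, nablaNr, nablaZl).

Lemma nabla_hproj X Y : nabla X (hp Y) = hp (nabla X Y).
Proof.
rewrite [in RHS](hproj_split Y) nablaDr nablaZr nablaT scaler0 addr0 !hprojE !thetaE.
rewrite (nabla_hor _ (theta_hproj Y)) thetaT mulr1 add0r addrK.
by [].
Qed.

Lemma theta_nabla X Y : theta (nabla X Y) = X (theta Y).
Proof.
rewrite [in LHS](hproj_split Y) nablaDr nablaZr nablaT scaler0 addr0 !thetaE.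
by rewrite (nabla_hor _ (theta_hproj Y)) thetaT mulr1 add0r.
Qed.

Lemma nabla_metric X Y Z : X (g Y Z) = g (nabla X Y) Z + g Y (nabla X Z).
Proof.
rewrite -[in LHS]metric_hprojl -[in LHS]metric_hprojr nabla_metric_hor ?theta_hproj//.
by rewrite !nabla_hproj !(metric_hprojl, metric_hprojr).
Qed.

(** * Parallelism of [J] *)

Definition nablaJ X Y := nabla X (J Y) - J (nabla X Y).
Local Notation D := nablaJ.

Lemma theta_nablaJ X Y : theta (D X Y) = 0.
Proof. by rewrite /nablaJ !thetaE theta_nabla !thetaJ vf_zerof subrr. Qed.

(* By [nabla_dform_defect] below, [q X Y Z = - (nabla_X dtheta)(Y, Z) / 2]. *)
Let q X Y Z := g Y (D X Z).

Lemma nabla_dform_defect X Y Z :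
  X (w Y Z) - w (nabla X Y) Z - w Y (nabla X Z) = - (q X Y Z + q X Y Z).
Proof.
rewrite !dform_metric /q /nablaJ !(vf_oppf, vf_addf) nabla_metric !metric_linE; ring.
Qed.

Let q_skew X Y Z : q X Y Z = - q X Z Y.
Proof.
apply/eqP; rewrite -addr_eq0; apply/eqP/Cdouble_eq0.
have := nabla_dform_defect X Y Z; have := nabla_dform_defect X Z Y.
rewrite (dformC _ Z Y) (dformC _ Z (nabla X Y)) (dformC _ (nabla X Z) Y) vf_oppf => e1 e2.
have -> : q X Y Z + q X Z Y + (q X Y Z + q X Z Y) =
  - (- (q X Z Y + q X Z Y)) - (- (q X Y Z + q X Y Z)) by ring.
by rewrite -e1 -e2; ring.
Qed.

(** The torsion of two horizontal fields points along [T], which [dtheta] annihilates. So brackets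
    may be replaced by differences of [nabla], and closedness of [dtheta] becomes a cyclic identity
    for its covariant derivative. *)
Let q_cyclic X Y Z : theta X = 0 -> theta Y = 0 -> theta Z = 0 ->
  q X Y Z + q Y Z X + q Z X Y = 0.
Proof.
move=> hX hY hZ; apply: Cdouble_eq0.
have := d2_dform theta X Y Z; rewrite /d2.
rewrite -(dform_hprojl (bracket X Y)) -(dform_hprojl (bracket X Z)) -(dform_hprojl (bracket Y Z)).
rewrite -!nabla_torsion// !dform_linE => e.
transitivity (- (X (w Y Z) - w (nabla X Y) Z - w Y (nabla X Z))
  - (Y (w Z X) - w (nabla Y Z) X - w Z (nabla Y X))
  - (Z (w X Y) - w (nabla Z X) Y - w X (nabla Z Y))).
  by rewrite !nabla_dform_defect; ring.
rewrite -[RHS]oppr0 -[in RHS]e (dformC _ Z X) (dformC _ Z (nabla _ _)) (dformC _ Y (nabla _ _)).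
rewrite (dformC _ X (nabla _ _)) vf_oppf; ring.
Qed.

(** By [N], each of [q (J X) Y Z], [q (J Y) Z X], [q (J Z) X Y] is the sum of the other two, which
    forces all three to vanish. Since [X = - J (J X)] on horizontal fields, the first slot is
    arbitrary. *)
Lemma nablaJ_hor X Y : theta X = 0 -> theta Y = 0 -> D X Y = 0.
Proof.
have N X1 Y1 Z1 : theta X1 = 0 -> theta Y1 = 0 -> theta Z1 = 0 ->
    q (J Z1) X1 Y1 = q (J X1) Y1 Z1 + q (J Y1) Z1 X1.
  move=> hX hY hZ.
  (* The second integrability condition, projected to [H] so that its brackets turn into differences
     of [nabla]. *)
  have e0 : J (D X1 Y1) - J (D Y1 X1) - D (J X1) Y1 + D (J Y1) X1 = 0.
    have := congr1 hp (J_integrable2 hX hY).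
    have -> : hp (bracket X1 Y1 - bracket (J X1) (J Y1)
        + J (bracket (J X1) Y1 + bracket X1 (J Y1)))
      = hp (bracket X1 Y1) - hp (bracket (J X1) (J Y1))
        + J (hp (bracket (J X1) Y1) + hp (bracket X1 (J Y1))).
      by rewrite [J (hp _ + _)]JD !J_hproj -JD !hprojE !thetaE thetaJ; vring.
    rewrite -!nabla_torsion// => e; rewrite [RHS](_ : 0 = hp 0); last first.
      by rewrite hproj_id// theta0.
    rewrite -e /nablaJ !JE !JJ -!nabla_hproj !hproj_id//.
    vring.
  have := congr1 (fun V => g Z1 V) e0; rewrite !metric_linE.
  rewrite [g Z1 0](_ : _ = 0); last by rewrite !metricE J0 -(scale0r 0) dformZr mul0r mulr0.
  rewrite -!/(q _ _ _) => e.
  have g1 U V : g Z1 (J (D U V)) = - q U (J Z1) V by rewrite /q metricJ opprK.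
  rewrite !g1 in e.
  have c := q_cyclic hX hY (thetaJ Z1).
  rewrite (q_skew X1 Y1) in c.
  rewrite (q_skew (J X1) Y1) -[RHS]subr0 -{}e -[LHS]subr0 -{}c.
  rewrite /q /nablaJ !metric_linE; ring.
move=> hX hY; apply: metric_eq0; first exact: theta_nablaJ.
move=> Z0; rewrite -metric_hprojl; have hZ := theta_hproj Z0; set Z := hp Z0 in hZ *.
suff JX0 : forall X', theta X' = 0 -> q (J X') Z Y = 0.
  have := JX0 _ (thetaJ X); rewrite JJ hproj_id// /q /nablaJ !nabla_linE !JE.
  rewrite -opprD metricNr => /eqP; rewrite oppr_eq0 => /eqP; exact.
move=> X' hX'; apply: Cdouble_eq0.
have n1 := N _ _ _ hZ hY hX'.
have n2 := N _ _ _ hY hX' hZ.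
have n3 := N _ _ _ hX' hZ hY.
set a := q (J X') Z Y in n2 n3 *; set b := q (J Z) Y X' in n2 n3.
set c := q (J Y) X' Z in n2 n3.
transitivity ((a + b) + (c + a) - b - c); first by ring.
by rewrite -n3 -n2; ring.
Qed.

(** The prescribed [nabla T] is the [J]-linear part of the Lie derivative along [T]. *)
Lemma nablaJ_char Y : theta Y = 0 -> D T Y = 0.
Proof.
move=> hY; rewrite /nablaJ (nabla_charE (thetaJ Y)) (nabla_charE hY).
have hb X : theta X = 0 -> theta (bracket T X) = 0.
  by move=> hX; have := wT X; rewrite !dformE hX thetaT vf_zerof vf_onef subrr sub0r
    => /eqP; rewrite oppr_eq0 => /eqP.
rewrite !JE !JJ !hproj_id ?hb ?thetaJ//.
rewrite bracketNr !JE; vring.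
Qed.

Lemma nabla_J X Y : nabla X (J Y) = J (nabla X Y).
Proof.
rewrite -(J_hproj Y) -(J_hproj (nabla X Y)) -nabla_hproj.
have hY := theta_hproj Y; move: (hp Y) hY => Y0 hY.
have hX := theta_hproj X; rewrite (hproj_split X); move: (hp X) hX => X0 hX.
rewrite !nablaDl !nablaZl !JE.
have /subr0_eq -> := nablaJ_hor hX hY.
by have /subr0_eq -> := nablaJ_char hY.
Qed.

(** * Pseudo-Hermitian torsion *)

Definition tau : vfield M -> vfield M :=
  locked (fun X => nabla T X - bracket T X).

Lemma tau_def X : tau X = nabla T X - bracket T X.
Proof. by rewrite /tau -lock. Qed.

Lemma tauD X Y : tau (X + Y) = tau X + tau Y.
Proof. by rewrite !tau_def nablaDr bracketDr; vring. Qed.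
Lemma tauZ f X : tau (f *: X) = f *: tau X.
Proof. by rewrite !tau_def nablaZr bracketZr; vring. Qed.
Lemma tauN X : tau (- X) = - tau X.
Proof. by rewrite -scaleN1r tauZ scaleN1r. Qed.
Definition tauE := (tauD, tauN, tauZ).

Lemma tau_T : tau T = 0.
Proof. by rewrite !tau_def nablaT; apply: vfield_ext => f; rewrite vfDE vfNE bracketE; ring. Qed.

Lemma tau_hproj X : tau (hp X) = tau X.
Proof. by rewrite hprojE !tauE tau_T scaler0 oppr0 addr0. Qed.

Lemma theta_bracketT X : theta (bracket T X) = T (theta X).
Proof.
have := wT X; rewrite !dformE thetaT vf_onef subr0 => /eqP.
by rewrite subr_eq0 => /eqP.
Qed.

(** On horizontal fields [nabla T] is the [J]-linear part of the Lie derivative along [T], so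
    [- tau] is its [J]-antilinear part. *)
Lemma tauJ X : tau (J X) = - J (tau X).
Proof.
rewrite -J_hproj -(tau_hproj X); have hX := theta_hproj X; move: (hp X) hX => {}X hX.
apply/eqP; rewrite -addr_eq0; apply/eqP.
have e : nabla T X + nabla T X = bracket T X - J (bracket T (J X)).
  by rewrite nabla_charE// -scalerDl Chalf_double scale1r.
have {e} := congr1 J e; rewrite !JE JJ hproj_id ?theta_bracketT ?thetaJ ?vf_zerof//.
rewrite !tau_def nabla_J !JE => e.
rewrite addrACA e; vring.
Qed.

Lemma nabla_dform X Y Z : X (w Y Z) = w (nabla X Y) Z + w Y (nabla X Z).
Proof.
by rewrite !dform_metric -nabla_J !(vf_oppf, vf_addf) nabla_metric; ring.
Qed.

(** Cartan's formula: [dtheta] is closed and its contraction with [T] vanishes, so its Lie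
    derivative along [T] does too. *)
Lemma lie_dform X Y : T (w X Y) = w (bracket T X) Y + w X (bracket T Y).
Proof.
have := d2_dform theta T X Y; rewrite /d2 !wT dformTr !vf_zerof (dformC _ (bracket T Y) X) => e.
rewrite -[LHS]subr0 -e; ring.
Qed.

(** Both [nabla T] and the Lie derivative along [T] preserve [dtheta]; their difference is therefore
    skew for it. Combined with [tauJ], this is symmetry of [tau] for [g]. *)
Lemma dform_tau X Y : w (tau X) Y = - w X (tau Y).
Proof.
apply/eqP; rewrite -addr_eq0; apply/eqP; rewrite !tau_def !dform_linE.
transitivity (T (w X Y) - T (w X Y)); last exact: subrr.
rewrite {1}nabla_dform lie_dform; ring.
Qed.

Lemma metric_tau X Y : g (tau X) Y = g X (tau Y).
Proof. by rewrite !metricE dform_tau tauJ dformNr opprK. Qed.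

Definition nablatau : vfield M -> vfield M -> vfield M :=
  locked (fun X Y => nabla X (tau Y) - tau (nabla X Y)).
Local Notation P := nablatau.

Lemma nablatau_def X Y : P X Y = nabla X (tau Y) - tau (nabla X Y).
Proof. by rewrite /nablatau -lock. Qed.

Lemma nablatauDl X Y Z : P (X + Y) Z = P X Z + P Y Z.
Proof. by rewrite !nablatau_def !nablaDl tauD; vring. Qed.
Lemma nablatauZl f X Y : P (f *: X) Y = f *: P X Y.
Proof. by rewrite !nablatau_def !nablaZl tauZ; vring. Qed.
Lemma nablatauDr X Y Z : P X (Y + Z) = P X Y + P X Z.
Proof. by rewrite !nablatau_def !(tauD, nablaDr); vring. Qed.
Lemma nablatauZr X f Y : P X (f *: Y) = f *: P X Y.
Proof. by rewrite !nablatau_def !(tauZ, nablaZr) tauD !tauZ; vring. Qed.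

Lemma nablatauJ X Y : P X (J Y) = - J (P X Y).
Proof. by rewrite !nablatau_def !(tauJ, nablaNr, nabla_J) !JE; vring. Qed.

Lemma metric_nablatau X Y Z : g (P X Y) Z = g Y (P X Z).
Proof.
rewrite !nablatau_def metricDl metricNl metricDr metricNr !metric_tau.
have e : X (g (tau Y) Z) = X (g Y (tau Z)) by rewrite metric_tau.
rewrite !nabla_metric !metric_tau in e.
transitivity (g (nabla X (tau Y)) Z + g Y (tau (nabla X Z))
   - g Y (tau (nabla X Z)) - g (nabla X Y) (tau Z)).
  by ring.
rewrite e; ring.
Qed.

Definition torsion X Y := w X Y *: T + theta X *: tau Y - theta Y *: tau X.

Lemma torsionE X Y : nabla X Y = nabla Y X + bracket X Y + torsion X Y.
Proof.
have e X0 Y0 : theta X0 = 0 -> theta Y0 = 0 ->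
    nabla X0 Y0 = nabla Y0 X0 + bracket X0 Y0 + w X0 Y0 *: T.
  move=> hX hY; rewrite dform_hor// scaleNr -addrA -hprojE -nabla_torsion//; vring.
have hX := theta_hproj X; have hY := theta_hproj Y.
have tX := tau_hproj X; have tY := tau_hproj Y.
rewrite /torsion -(dform_hprojl X) -(dform_hprojr _ Y) -tX -tY.
rewrite [in LHS](hproj_split X) [in LHS](hproj_split Y).
rewrite [bracket X Y](_ : _ = bracket (hp X + theta X *: T) (hp Y + theta Y *: T)); last first.
  by rewrite -!hproj_split.
rewrite [nabla Y X](_ : _ = nabla (hp Y + theta Y *: T) (hp X + theta X *: T)); last first.
  by rewrite -!hproj_split.
move: (theta X) (theta Y) {tX tY} => a b; move: (hp X) (hp Y) hX hY => X0 Y0 hX hY.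
rewrite !nablaDl !nablaDr !nablaZl !nablaZr !nablaT (e _ _ hX hY) !tau_def.
rewrite !bracketDl !bracketDr !bracketZl !bracketZr (bracketC X0 T).
rewrite [bracket T T](_ : _ = 0); last first.
  by apply: vfield_ext => f; rewrite bracketE subrr.
apply: vfield_ext => f; rewrite !(vfDE, vfNE, vfZE, vf0E); ring.
Qed.

(** * Curvature and the Bianchi identities *)

Definition curv : vfield M -> vfield M -> vfield M -> vfield M :=
  locked (curvature nabla).
Local Notation Rm := curv.

Lemma curv_def X Y Z : Rm X Y Z =
  nabla X (nabla Y Z) - nabla Y (nabla X Z) - nabla (bracket X Y) Z.
Proof. by rewrite /curv -lock. Qed.

Lemma curvC X Y Z : Rm X Y Z = - Rm Y X Z.
Proof. by rewrite !curv_def (bracketC X) nablaNl; vring. Qed.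
Lemma curvDl X X' Y Z : Rm (X + X') Y Z = Rm X Y Z + Rm X' Y Z.
Proof. by rewrite !curv_def bracketDl !(nablaDl, nablaDr); vring. Qed.
Lemma curvZl f X Y Z : Rm (f *: X) Y Z = f *: Rm X Y Z.
Proof. by rewrite !curv_def bracketZl !(nablaDl, nablaNl, nablaZl, nablaZr); vring. Qed.
Lemma curvDm X Y Y' Z : Rm X (Y + Y') Z = Rm X Y Z + Rm X Y' Z.
Proof. by rewrite curvC curvDl opprD -!(curvC X). Qed.
Lemma curvZm f X Y Z : Rm X (f *: Y) Z = f *: Rm X Y Z.
Proof. by rewrite curvC curvZl -scalerN -(curvC X). Qed.
Lemma curvDr X Y Z Z' : Rm X Y (Z + Z') = Rm X Y Z + Rm X Y Z'.
Proof. by rewrite !curv_def !nablaDr; vring. Qed.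
Lemma curvZr X Y f Z : Rm X Y (f *: Z) = f *: Rm X Y Z.
Proof.
rewrite !curv_def !(nablaDr, nablaZr).
apply: vfield_ext => h; rewrite !(vfDE, vfNE, vfZE, bracketE); ring.
Qed.
Lemma curvJ X Y Z : Rm X Y (J Z) = J (Rm X Y Z).
Proof. by rewrite !curv_def !nabla_J !JE. Qed.

Lemma curvT X Y : Rm X Y T = 0.
Proof. by rewrite !curv_def !nablaT !nabla0r; vring. Qed.

Lemma theta_curv X Y Z : theta (Rm X Y Z) = 0.
Proof. by rewrite !curv_def !thetaE !theta_nabla bracketE; ring. Qed.

Lemma metric_curv X Y Z W : g (Rm X Y Z) W = - g Z (Rm X Y W).
Proof.
apply/eqP; rewrite -addr_eq0; apply/eqP.
have := bracketE X Y (g Z W).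
rewrite !(nabla_metric, vf_addf) => /eqP; rewrite -subr_eq0 => /eqP e.
rewrite -[RHS]oppr0 -[in RHS]e !curv_def !metric_linE; ring.
Qed.

Lemma bianchi1 X Y Z : Rm X Y Z + Rm Y Z X + Rm Z X Y =
  (torsion X (bracket Y Z) + nabla X (torsion Y Z))
  + (torsion Y (bracket Z X) + nabla Y (torsion Z X))
  + (torsion Z (bracket X Y) + nabla Z (torsion X Y)).
Proof.
rewrite !curv_def (torsionE Y Z) (torsionE Z X) (torsionE X Y) !nablaDr.
rewrite (torsionE X (bracket Y Z)) (torsionE Y (bracket Z X)) (torsionE Z (bracket X Y)).
have jac : bracket X (bracket Y Z) + bracket Y (bracket Z X) + bracket Z (bracket X Y) = 0.
  by apply: vfield_ext => f; rewrite !(vfDE, vf0E, bracketE) !(vf_addf, vf_oppf); ring.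
rewrite -[RHS]addr0 -jac; vring.
Qed.

(** The components along [T] add up to [d (dtheta) = 0]; the [tau] terms come from [- theta [Y, Z] =
    dtheta(Y, Z)]. *)
Lemma bianchi1_hor X Y Z : theta X = 0 -> theta Y = 0 -> theta Z = 0 ->
  Rm X Y Z + Rm Y Z X + Rm Z X Y = w X Y *: tau Z + w Y Z *: tau X + w Z X *: tau Y.
Proof.
move=> hX hY hZ; rewrite bianchi1 /torsion hX hY hZ.
rewrite !scale0r !subr0 !addr0 !nablaZr !nablaT.
rewrite [in RHS]dform_hor// [in w Y Z *: tau _]dform_hor// [in w Z X *: tau _]dform_hor//.
have := congr1 (fun c : C => c *: T) (d2_dform theta X Y Z); rewrite scale0r /d2 => e.
rewrite -[RHS]addr0 -[in RHS]e (bracketC Z X) (dformC _ Z X) vf_oppf.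
rewrite (dformC _ (bracket X Y) Z) (dformC _ (bracket Y Z) X) (dformC _ (bracket X Z) Y).
rewrite dformNr !thetaN; vring.
Qed.

(** The components along [T] cancel because [dtheta] is invariant along [T]; the rest assembles into
    covariant derivatives of [tau]. *)
Lemma bianchi1_char X Y : theta X = 0 -> theta Y = 0 ->
  Rm T X Y - Rm T Y X = P Y X - P X Y.
Proof.
move=> hX hY; have := bianchi1 T X Y; rewrite curvT addr0 (curvC Y T) => ->.
have hT Z : theta Z = 0 -> theta (bracket T Z) = 0.
  by move=> hZ; rewrite theta_bracketT hZ vf_zerof.
rewrite (bracketC Y T) /torsion !thetaN !hT// hX hY thetaT !wT !(dformTr, dformNr).
rewrite !(scale0r, scale1r, oppr0, addr0, add0r, subr0, sub0r).
rewrite ?(nablaDr, nablaNr) !nablaZr !nablaT.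
rewrite (_ : bracket X Y = nabla X Y - nabla Y X + theta (bracket X Y) *: T); last first.
  by rewrite nabla_torsion// -hproj_split.
rewrite !tauE tau_T !nablatau_def.
have := lie_dform X Y; rewrite (dformC _ _ Y) => e.
rewrite e (dformC _ Y (bracket T X)); vring.
Qed.

(** With brackets in place of torsion, this is the Jacobi identity for the operators [nabla X],
    [nabla Y], [nabla Z] together with that for the fields. *)
Lemma bianchi2 X Y Z W :
  (nabla X (Rm Y Z W) - Rm Y Z (nabla X W))
  + (nabla Y (Rm Z X W) - Rm Z X (nabla Y W))
  + (nabla Z (Rm X Y W) - Rm X Y (nabla Z W))
  = Rm (bracket X Y) Z W + Rm (bracket Y Z) X W + Rm (bracket Z X) Y W.
Proof.
have jac : bracket (bracket X Y) Z + bracket (bracket Y Z) X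
    + bracket (bracket Z X) Y = 0.
  by apply: vfield_ext => f; rewrite !(vfDE, vf0E, bracketE) !(vf_addf, vf_oppf); ring.
rewrite !curv_def !(nablaDr, nablaNr) -[RHS]addr0 -(nabla0l W) -jac !nablaDl; vring.
Qed.

(** * Traces of the curvature *)

Section Trace.
Variables (p : M) (N : nat) (e : 'I_N -> vfield M) (b : C).
Hypothesis theta_e : forall i, theta (e i) = 0.
Hypothesis bp : b p != 0.
Hypothesis e_orthonormal : forall i j, b * (g (e i) (e j) - (i == j)%:R) = 0.

Hypothesis e_expand : forall K, pt_linear p K -> forall X, theta X = 0 ->
  K X = \sum_l g X (e l) p * K (e l).

(** Expanding [phi (e l)] in the frame, a skew matrix changes slot at the cost of a sign. Linearity
    of [phi] is not asked for, so that [nabla X] qualifies as well as [J]. *)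
Lemma trace_skew (B : vfield M -> vfield M -> R) (phi : vfield M -> vfield M) :
  (forall Y, pt_linear p (B^~ Y)) -> (forall X, pt_linear p (B X)) ->
  (forall l, theta (phi (e l)) = 0) ->
  (forall k l, g (phi (e k)) (e l) p = - g (e k) (phi (e l)) p) ->
  \sum_l B (e l) (phi (e l)) = - \sum_l B (phi (e l)) (e l).
Proof.
move=> Bl Br hphi phi_skew.
under eq_bigr => l _ do rewrite (e_expand (Br _) (hphi l)).
under [in RHS]eq_bigr => l _ do rewrite (e_expand (Bl _) (hphi l)).
rewrite exchange_big -sumrN; apply: eq_bigr => k _.
rewrite -sumrN; apply: eq_bigr => l _.
by rewrite phi_skew mulNr metricC.
Qed.

Lemma trace_J (B : vfield M -> vfield M -> R) :
  (forall Y, pt_linear p (B^~ Y)) -> (forall X, pt_linear p (B X)) ->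
  \sum_l B (e l) (J (e l)) = - \sum_l B (J (e l)) (e l).
Proof.
move=> Bl Br; apply: (@trace_skew B J) => // k l.
by rewrite metricJ CfunE.
Qed.

(** The orthonormality relation multiplied by [b] is differentiated at [p]; the term containing
    [X b] drops out because the relation itself holds at [p]. *)
Lemma nabla_e_skew X k l :
  g (nabla X (e k)) (e l) p = - g (e k) (nabla X (e l)) p.
Proof.
have /(congr1 (fun h : C => X h p)) := e_orthonormal k l.
rewrite vf_mulf vf_zerof vf_addf vf_oppf nabla_metric !CfunE.
have -> : X (k == l)%:R = 0 by case: eqP => _; rewrite ?vf_onef ?vf_zerof.
have /(congr1 (fun h : C => h p)) := e_orthonormal k l.
rewrite !CfunE => /eqP; rewrite mulf_eq0 (negPf bp) /= => /eqP ->.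
rewrite mul0r addr0 oppr0 addr0 => /eqP; rewrite mulf_eq0 (negPf bp) /=.
by rewrite addr_eq0 => /eqP.
Qed.

Ltac lin := rewrite /pt_linear; intros; cbv beta;
  rewrite ?(JE, tauE, curvDl, curvZl, curvDm, curvZm, curvDr, curvZr,
    nablatauDl, nablatauZl, nablatauDr, nablatauZr, metric_linE, CfunE);
  ring.

(** A function on all of [M], which vector fields can differentiate, although it is the trace over
    [H] only where [e] is orthonormal. *)
Definition ricci_trace X Y := \sum_l g (Rm X Y (J (e l))) (e l).
Local Notation A := ricci_trace.

(** The two contributions from differentiating the frame cancel because the connection matrix is
    skew. *)
Lemma d_ricci_trace X Y Z : X (A Y Z) p =
  \sum_l g (nabla X (Rm Y Z (J (e l))) - Rm Y Z (nabla X (J (e l)))) (e l) p.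
Proof.
rewrite /ricci_trace vf_sumf Cfun_sum.
under eq_bigr => l _ do rewrite nabla_metric CfunE.
under [in RHS]eq_bigr => l _ do rewrite metricDl metricNl CfunE nabla_J.
rewrite !big_split /=; congr (_ + _).
rewrite (@trace_skew (fun U V => g (Rm Y Z (J U)) V p) (nabla X)).
- by rewrite -sumrN.
- by lin.
- by lin.
- by move=> l; rewrite theta_nabla theta_e vf_zerof.
- exact: nabla_e_skew.
Qed.

Lemma ricci_traceC X Y : A X Y = - A Y X.
Proof. by rewrite -sumrN; apply: eq_bigr => l _; rewrite curvC metricNl. Qed.

Lemma ricci_trace_closed X Y Z : d2 A X Y Z p = 0.
Proof.
have AN U V : A (- U) V = - A U V.
  by rewrite /ricci_trace -sumrN; apply: eq_bigr => l _;
    rewrite -scaleN1r curvZl scaleN1r metricNl.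
have -> : d2 A X Y Z = X (A Y Z) + Y (A Z X) + Z (A X Y)
    - (A (bracket X Y) Z + A (bracket Y Z) X + A (bracket Z X) Y).
  by rewrite /d2 (ricci_traceC Z X) (bracketC Z X) AN vf_oppf; ring.
rewrite !(CfunD, CfunN) !d_ricci_trace /ricci_trace !Cfun_sum -!big_split -sumrB.
apply: big1 => l _ /=; rewrite -!CfunD -CfunB -!metricDl bianchi2 !metricDl.
by rewrite subrr.
Qed.

Lemma dform_Jr X Y : w X (J Y) = g X Y + g X Y.
Proof. by rewrite dform_metric JJ metricNr metric_hprojr; ring. Qed.

(** The common value to which both traces are reduced, after skew-symmetrization; since [J] commutes
    with curvature it is [- g (Ric X) (J Y)]. *)
Let L X Y := \sum_l g (Rm X (e l) (J (e l))) Y p.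

Let sum_curvJ X Y : \sum_l g (Rm X (J (e l)) (e l)) Y p = - L X Y.
Proof.
rewrite /L (@trace_J (fun U V => g (Rm X U V) Y p)) ?opprK//.
- by lin.
- by lin.
Qed.

(** The first Bianchi identity on [(J e_l, e_l, X)] gives [2 L X Y] plus a multiple of
    [g (tau X) Y]. The left side is skew in [X] and [Y] and the torsion term is symmetric, so
    skew-symmetrizing removes the latter. The 4 collects two torsion sums, each equal to
    [2 g (tau X) Y]. *)
Let trace_curvJ X Y : theta X = 0 -> theta Y = 0 ->
  \sum_l g (Rm (J (e l)) (e l) X) Y p = L X Y - L Y X.
Proof.
have H X1 Y1 : theta X1 = 0 -> \sum_l g (Rm (J (e l)) (e l) X1) Y1 p =
    L X1 Y1 + L X1 Y1 + (\sum_l w (J (e l)) (e l) p + 4) * g (tau X1) Y1 p.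
  move=> hX.
  have -> : \sum_l g (Rm (J (e l)) (e l) X1) Y1 p =
      L X1 Y1 - \sum_l g (Rm X1 (J (e l)) (e l)) Y1 p
      + (\sum_l w (J (e l)) (e l) p) * g (tau X1) Y1 p
      - \sum_l 2 * (g (J X1) (e l) p * g (tau (J (e l))) Y1 p)
      + \sum_l 2 * (g X1 (e l) p * g (tau (e l)) Y1 p).
    rewrite /L mulr_suml -!sumrN -!big_split; apply: eq_bigr => l _ /=.
    have := bianchi1_hor (thetaJ (e l)) (theta_e l) hX.
    move=> /(congr1 (fun V => g V Y1 p)).
    rewrite (curvC (e l)) !(metricDl, metricNl, metricZl) -(dformJJ (e l)) (dformC _ (J (e l)) (J X1)) !dform_Jr.
    rewrite !CfunE => E.
    transitivity (g (Rm (J (e l)) (e l) X1) Y1 p - g (Rm X1 (e l) (J (e l))) Y1 p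
      + g (Rm X1 (J (e l)) (e l)) Y1 p + g (Rm X1 (e l) (J (e l))) Y1 p
      - g (Rm X1 (J (e l)) (e l)) Y1 p); first by ring.
    rewrite E; ring.
  rewrite sum_curvJ -!mulr_sumr.
  rewrite -(e_expand (K := fun U => g (tau (J U)) Y1 p)) ?thetaJ//; last by lin.
  rewrite -(e_expand (K := fun U => g (tau U) Y1 p)) ?thetaJ//; last by lin.
  rewrite JJ hproj_id// tauN metricNl CfunE; ring.
move=> hX hY.
have := H X Y hX; have := H Y X hY; rewrite metric_tau metricC.
have -> : \sum_l g (Rm (J (e l)) (e l) Y) X p
    = - \sum_l g (Rm (J (e l)) (e l) X) Y p.
  by rewrite -sumrN; apply: eq_bigr => l _; rewrite metric_curv metricC CfunE.
lra.
Qed.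

(** This stands in for pair symmetry. The first Bianchi identity on [(X, Y, J e_l)] brings the right
    side to [L X Y - L Y X] as well: one torsion term contains the trace of [tau] composed with [J],
    the other two cancel by symmetry of [tau]. *)
Lemma ricci_trace_hor X Y : theta X = 0 -> theta Y = 0 ->
  \sum_l g (Rm (J (e l)) (e l) X) Y p = A X Y p.
Proof.
move=> hX hY; rewrite trace_curvJ// /ricci_trace Cfun_sum.
(* Moving [J] to the other slot changes the sign, moving the symmetric [tau] does not. *)
have tau0 : \sum_l g (tau (J (e l))) (e l) p = 0.
  have := @trace_J (fun U V => g (tau U) V p).
  have -> : \sum_l g (tau (e l)) (J (e l)) p = \sum_l g (tau (J (e l))) (e l) p.
    by apply: eq_bigr => l _; rewrite metric_tau metricC.
  move=> /(_ _ _)/eqP; rewrite -addr_eq0 -mulr2n mulrn_eq0 /= => H.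
  by apply/eqP/H; lin.
have -> : \sum_l g (Rm X Y (J (e l))) (e l) p =
   \sum_l g (Rm Y (J (e l)) (e l)) X p
   - \sum_l g (Rm X (J (e l)) (e l)) Y p
   + w X Y p * (\sum_l g (tau (J (e l))) (e l) p)
   + \sum_l 2 * (g Y (e l) p * g (tau X) (e l) p)
   - \sum_l 2 * (g X (e l) p * g (tau Y) (e l) p).
  rewrite mulr_sumr -!sumrN -!big_split; apply: eq_bigr => l _ /=.
  have := bianchi1_hor hX hY (thetaJ (e l)).
  move=> /(congr1 (fun V => g V (e l) p)).
  rewrite !(metricDl, metricZl) (metric_curv Y (J (e l)) X) (curvC (J (e l)) X Y) metricNl.
  rewrite (metric_curv X (J (e l)) Y) (metricC X) (metricC Y (Rm _ _ _)).
  rewrite (dformC _ (J (e l)) X) !dform_Jr !CfunE; lra.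
rewrite !sum_curvJ tau0 -!mulr_sumr.
rewrite -(e_expand (K := fun U => g (tau X) U p))//; last by lin.
rewrite -(e_expand (K := fun U => g (tau Y) U p))//; last by lin.
rewrite (metric_tau Y) (metricC Y); ring.
Qed.

(** An endomorphism anticommuting with [J] has trace zero. *)
Let trace_nablatau X : \sum_l g (P X (e l)) (e l) p = 0.
Proof.
have := @trace_J (fun U V => g (P X U) (J V) p).
have -> : \sum_l g (P X (e l)) (J (J (e l))) p = - \sum_l g (P X (e l)) (e l) p.
  by rewrite -sumrN; apply: eq_bigr => l _; rewrite JJ metricNr metric_hprojr CfunE.
have -> : \sum_l g (P X (J (e l))) (J (e l)) p = - \sum_l g (P X (e l)) (e l) p.
  rewrite -sumrN; apply: eq_bigr => l _.
  by rewrite nablatauJ metricNl metricJ JJ opprK metricNr metric_hprojr CfunE.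
move=> /(_ _ _)/eqP; rewrite opprK eq_sym -addr_eq0 -mulr2n mulrn_eq0 /= => H.
by apply/eqP/H; lin.
Qed.

(** The trace of a symmetric endomorphism composed with a skew one is zero. *)
Let trace_nablatauJ X : \sum_l g (P X (J (e l))) (e l) p = 0.
Proof.
have := @trace_J (fun U V => g (P X U) V p).
have -> : \sum_l g (P X (e l)) (J (e l)) p = \sum_l g (P X (J (e l))) (e l) p.
  by apply: eq_bigr => l _; rewrite metric_nablatau metricC.
move=> /(_ _ _)/eqP; rewrite -addr_eq0 -mulr2n mulrn_eq0 /= => H.
by apply/eqP/H; lin.
Qed.

(** Ric(T) is the divergence of [tau]: in the traced mixed Bianchi identity, [R(T, Y)] is skew and
    the derivative of [tau] along [Y] is traceless. *)
Let trace_curv_char Y : theta Y = 0 ->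
  \sum_l g (Rm T (e l) (e l)) Y p = \sum_l g (P (e l) (e l)) Y p.
Proof.
move=> hY; rewrite -[RHS]subr0 -[X in _ - X](trace_nablatau Y) -sumrB.
apply: eq_bigr => l _; have := bianchi1_char (theta_e l) hY.
move=> /(congr1 (fun V => g V (e l) p)).
have R0 : g (Rm T Y (e l)) (e l) p = 0.
  by have := congr1 (fun h : C => h p) (metric_curv T Y (e l) (e l)); rewrite metricC CfunE; lra.
rewrite !(metricDl, metricNl) !CfunE R0 (metric_curv T (e l) Y) (metricC Y) (metric_nablatau (e l) Y) (metricC Y).
rewrite CfunE; lra.
Qed.

(** The mixed Bianchi identity splits the trace into a curvature term and a divergence of [tau].
    Each contributes [- g (Ric T) (J X)], whence the factor 2. *)
Lemma ricci_trace_char X : theta X = 0 ->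
  A T X p = - 2 * \sum_l g (Rm T (e l) (e l)) (J X) p.
Proof.
move=> hX; rewrite /ricci_trace Cfun_sum.
have -> : \sum_l g (Rm T X (J (e l))) (e l) p =
    - \sum_l g (Rm T (J (e l)) (e l)) X p
    + \sum_l g (P (J (e l)) (e l)) X p - \sum_l g (P X (J (e l))) (e l) p.
  rewrite -!sumrN -!big_split; apply: eq_bigr => l _ /=.
  have := bianchi1_char hX (thetaJ (e l)).
  move=> /(congr1 (fun V => g V (e l) p)).
  rewrite !(metricDl, metricNl) (metric_curv T (J (e l)) X) (metric_nablatau (J (e l)) X).
  rewrite !(metricC X) !CfunE; lra.
have e1 := @trace_J (fun U V => g (Rm T U V) X p).
rewrite -e1; [|by lin|by lin].
have e2 := @trace_J (fun U V => g (P U V) X p).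
rewrite -[\sum_l g (P (J (e l)) (e l)) X p]opprK -e2; [|by lin|by lin].
rewrite trace_nablatauJ subr0 mulNr -mulrN mulrDl mul1r.
have -> : \sum_l g (Rm T (e l) (J (e l))) X p = - \sum_l g (Rm T (e l) (e l)) (J X) p.
  by rewrite -sumrN; apply: eq_bigr => l _; rewrite curvJ metricJ CfunE.
rewrite (trace_curv_char (thetaJ X)); congr (_ + _).
by apply: congr1; apply: eq_bigr => l _; rewrite nablatauJ metricNl metricJ opprK.
Qed.

End Trace.

(** * The Ricci form *)

Section Ricci.
Variables (H : M -> set (C -> R)) (Ric : vfield M -> vfield M).
Variable rho : vfield M -> vfield M -> C.
Hypothesis H_subbundle : subbundle m.*2 H.
Hypothesis HE : forall X p, H p (value X p) <-> theta X p = 0.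
Hypothesis metric_gt0 : forall X p, theta X = 0 -> value X p <> 0 -> 0 < g X X p.
Hypothesis RicE : forall (U : set M) (e : 'I_m.*2 -> vfield M), open U ->
  (forall i, theta (e i) = 0) ->
  (forall p, U p -> forall i j, g (e i) (e j) p = (i == j)%:R) ->
  forall p, U p -> value (Ric T) p = value (\sum_l Rm T (e l) (e l)) p.
Hypothesis rhoE : forall X Y (U : set M) (e : 'I_m.*2 -> vfield M), open U ->
  (forall i, theta (e i) = 0) ->
  (forall p, U p -> forall i j, g (e i) (e j) p = (i == j)%:R) ->
  forall p, U p ->
  rho X Y p = 2^-1 * \sum_l g (Rm (J (e l)) (e l) (hp X)) (hp Y) p.

Let g_linear f X Y Z : g (f *: X + Y) Z = f * g X Z + g Y Z.
Proof. by rewrite metricDl metricZl. Qed.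

(** Orthonormality is needed in two forms: multiplied by [b], to be differentiated, and pointwise on
    the open set where [b] is nonzero, as the formulas defining [Ric] and [rho] require. *)
Lemma frame_near p : exists (e : 'I_m.*2 -> vfield M) (b : C),
  [/\ forall i, theta (e i) = 0, b p != 0,
      forall i j, b * (g (e i) (e j) - (i == j)%:R) = 0
    & forall r, [set r | b r != 0] r -> forall i j, g (e i) (e j) r = (i == j)%:R].
Proof.
have [e [b [he bp eo]]] := gram_schmidt H_subbundle HE thetaT metricC g_linear metric_gt0 p.
exists e, b; split=> // r /= br i j.
have /(congr1 (fun f : C => f r)) := eo i j.
rewrite !CfunE => /eqP; rewrite mulf_eq0 (negPf br) /= subr_eq0 => /eqP ->.
by case: eqP.
Qed.

Lemma theta_Ric : theta (Ric T) = 0.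
Proof.
apply: Csmooth_ext => p; have [e [b [he bp _ eo]]] := frame_near p.
apply/HE; rewrite (RicE (open_neq0 b) he eo bp); apply/HE.
by rewrite linear_sum big1// => l _; exact: theta_curv.
Qed.

(** On horizontal arguments [d rho] differs from half of [d A] only in the bracket terms, the
    brackets being the only arguments with a component along [T]. *)
Lemma d2_ricci_form X Y Z : theta X = 0 -> theta Y = 0 -> theta Z = 0 ->
  d2 rho X Y Z = - wedge12 (g (J (Ric T))) w X Y Z.
Proof.
move=> hX hY hZ; apply: Csmooth_ext => p.
have [e [b [he bp beo eo]]] := frame_near p.
have ex r : b r != 0 -> forall K, pt_linear r K -> forall V, theta V = 0 ->
    K V = \sum_l g V (e l) r * K (e l).
  move=> br K Kl V hV.
  exact: (orthonormal_expand H_subbundle HE thetaT g_linear he (eo r br)).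
pose A := ricci_trace e.
have rhoA U V r : b r != 0 -> rho U V r = 2^-1 * A (hp U) (hp V) r.
  move=> br; rewrite (rhoE U V (open_neq0 b) he eo br); congr (_ * _).
  by apply: (ricci_trace_hor he (ex r br)); exact: theta_hproj.
(* The local identity [rhoA], made global by the factor [b], is differentiated at [p]. *)
have drho V1 V2 V3 : V1 (rho V2 V3) p = 2^-1 * V1 (A (hp V2) (hp V3)) p.
  have : b * (rho V2 V3 - 2^-1 *: A (hp V2) (hp V3)) = 0.
    apply: Csmooth_ext => r; rewrite CfunM CfunB CfunZ Cfun0.
    have [->|br] := eqVneq (b r) 0; first by rewrite mul0r.
    by rewrite rhoA// subrr mulr0.
  move=> /(congr1 (fun f : C => V1 f p)); rewrite vf_zerof vf_mulf vf_addf vf_oppf vf_scalef.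
  rewrite !(CfunD, CfunM, CfunN, CfunZ, Cfun0) (rhoA V2 V3 p bp) subrr mul0r addr0.
  by move=> /eqP; rewrite mulf_eq0 (negPf bp) /= subr_eq0 => /eqP.
have AT V : theta V = 0 -> A T V p = 2 * g (J (Ric T)) V p.
  move=> hV; rewrite /A (ricci_trace_char he (ex p bp) hV) metricJ CfunN mulNr mulrN.
  congr (- (_ * _)).
  have gl : pt_linear p (fun U => g U (J V) p) by move=> f U1 U2; rewrite g_linear.
  rewrite -(pt_linear_sum gl); apply/eqP; rewrite eq_sym -subr_eq0 -(pt_linearB gl).
  apply/eqP/(pt_linear_eq0 H_subbundle HE thetaT gl).
    by rewrite thetaD thetaN theta_Ric sub0r linear_sum big1 ?oppr0// => l _; exact: theta_curv.
  by rewrite valueB (RicE (open_neq0 b) he eo bp) subrr.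
have AZ (f : C) U V W : A (U - f *: V) W p = A U W p - f p * A V W p.
  rewrite /A /ricci_trace !Cfun_sum mulr_sumr -sumrB; apply: eq_bigr => l _.
  by rewrite curvDl -scaleN1r !curvZl metricDl !metricZl !(CfunD, CfunM, CfunN, Cfun1) mulN1r.
(* Projecting the bracket subtracts [theta [V1, V2] T], where [- theta [V1, V2] = dtheta(V1, V2)];
   the factor 2 of [AT] absorbs the one half. *)
have Ahp V1 V2 V3 : theta V1 = 0 -> theta V2 = 0 -> theta V3 = 0 ->
    rho (bracket V1 V2) V3 p
    = 2^-1 * A (bracket V1 V2) V3 p + w V1 V2 p * g (J (Ric T)) V3 p.
  move=> h1 h2 h3; rewrite rhoA// (hproj_id h3) hprojE AZ AT// dform_hor// CfunN; lra.
have := ricci_trace_closed he bp beo (ex p bp) X Y Z; rewrite -/A /d2 /wedge12.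
rewrite !(CfunD, CfunN, CfunM) !drho !hproj_id// !Ahp//; lra.
Qed.

End Ricci.

End TanakaWebster.

(** * Extension of [J] to all vector fields and passage from the definitions *)

Theorem lemma2p3 (R : realType) (m : nat) (M : manifold R m.*2.+1)
    (H : M -> set (Csmooth M -> R)) (J : vfield M -> vfield M)
    (theta : {scalar vfield M}) (T : vfield M)
    (nabla : vfield M -> vfield M -> vfield M)
    (Ric : vfield M -> vfield M) (rho : vfield M -> vfield M -> Csmooth M) :
  (1 <= m)%N ->
  connected [set: M] ->
  orientable M ->
  CR_structure H J ->
  strictly_pseudoconvex H J ->
  pseudo_hermitian H J theta ->
  characteristic_vfield theta T ->
  tanaka_webster H J theta T nabla ->
  is_Ricci H J theta nabla Ric ->
  is_Ricci_form H J theta T nabla rho ->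
  forall X Y Z : vfield M,
    dW theta T rho X Y Z
    = - wedge12 (flat theta J T (J (Ric T))) (d1 theta) X Y Z.
Proof.
move=> _ _ _ [subH JH Jlin JJ integ] _ [HE gpos] [thetaT dT].
move=> [conn [nablaT nablaH] gmetric tors charE] RicE rhoE X Y Z.
have secE V : sections H V <-> theta V = 0.
  split=> [hV|hV p]; first by apply: Csmooth_ext => p; apply/HE; exact: hV.
  by apply/HE; rewrite hV.
have secI V : theta V = 0 -> sections H V by move=> /secE.
(* [J] is arbitrary off the sections of [H]; [J'] is a global tensor with [J' T = 0]. *)
pose J' V := J (hproj theta T V).
have wE V W : d1 theta V W = dform theta V W by rewrite dformE.
have wT V : dform theta T V = 0 by rewrite -wE.
have hhp V := theta_hproj thetaT V.
have J'E V : theta V = 0 -> J' V = J V by move=> hV; rewrite /J' hproj_id.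
have hJ V : theta V = 0 -> theta (J V) = 0 by move=> /secE/JH/secE.
have thetaJ' V : theta (J' V) = 0 by exact: hJ.
have J'lin f V W : J' (f *: V + W) = f *: J' V + J' W.
  rewrite /J' -Jlin; [|exact/secE|exact/secE]; congr J.
  by rewrite !hprojE (thetaD theta) (thetaZ theta); vring.
have J'J' V : J' (J' V) = - hproj theta T V.
  by rewrite (J'E _ (thetaJ' V)) /J' JJ//; exact/secE.
(* Only the second argument passes through [J], so only that one has to be horizontal. *)
have gE V W : theta W = 0 -> gtheta theta J V W = metric theta J' V W.
  by move=> hW; rewrite metricE J'E// /gtheta wE ChalfM.
have gpos' V p : theta V = 0 -> value V p <> 0 -> 0 < metric theta J' V V p.
  by move=> hV Vp; rewrite -gE//; apply: gpos => //; exact/secE.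
have i1 V W : theta V = 0 -> theta W = 0 ->
    theta (bracket (J' V) W + bracket V (J' W)) = 0.
  move=> hV hW; rewrite !J'E//; apply/secE.
  by have [] := integ V W (secI V hV) (secI W hW).
have i2 V W : theta V = 0 -> theta W = 0 -> bracket V W - bracket (J' V) (J' W)
    + J' (bracket (J' V) W + bracket V (J' W)) = 0.
  move=> hV hW; rewrite (J'E _ (i1 V W hV hW)) !J'E//.
  by have [] := integ V W (secI V hV) (secI W hW).
have nondeg V : theta V = 0 ->
    (forall W, theta W = 0 -> metric theta J' V W = 0) -> V = 0.
  move=> hV gV; apply: vfield_value => p; apply: contrapT => Vp.
  by have := gpos' V p hV Vp; rewrite gV// Cfun0 ltxx.
have nablaH' V W : theta W = 0 -> theta (nabla V W) = 0.
  by move=> hW; apply/secE/nablaH; exact: secI.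
have gmetric' (U V W : vfield M) : theta V = 0 -> theta W = 0 ->
    U (metric theta J' V W)
    = metric theta J' (nabla U V) W + metric theta J' V (nabla U W).
  by move=> hV hW; rewrite -!gE ?nablaH'//; apply: gmetric; exact: secI.
have tors' V W : theta V = 0 -> theta W = 0 ->
    nabla V W - nabla W V = hproj theta T (bracket V W).
  by move=> hV hW; apply: tors; exact: secI.
have brT V : theta V = 0 -> theta (bracket T V) = 0.
  move=> hV; have := dT V; rewrite /d1 hV thetaT vf_zerof vf_onef subrr sub0r.
  by move/eqP; rewrite oppr_eq0 => /eqP.
have charE' V : theta V = 0 ->
    nabla T V = Chalf *: (bracket T V - J' (bracket T (J' V))).
  by move=> hV; rewrite charE ?J'E ?brT ?hJ//; exact: secI.
have curvE V1 V2 V3 : curvature nabla V1 V2 V3 = curv nabla V1 V2 V3.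
  by rewrite curv_def.
have frameE U (e : 'I_m.*2 -> vfield M) : (forall i, theta (e i) = 0) ->
    (forall p, U p -> forall i j, metric theta J' (e i) (e j) p = (i == j)%:R) ->
    orthonormal_frame H J theta U e.
  move=> he eo; split=> [i|p Up i j]; first exact: secI.
  by rewrite gE// eo.
have RicE' U (e : 'I_m.*2 -> vfield M) : open U -> (forall i, theta (e i) = 0) ->
    (forall p, U p -> forall i j, metric theta J' (e i) (e j) p = (i == j)%:R) ->
    forall p, U p -> value (Ric T) p = value (\sum_l curv nabla T (e l) (e l)) p.
  move=> oU he eo p Up; rewrite (RicE T U e oU (frameE _ _ he eo) p Up).
  by under eq_bigr do rewrite curvE.
have rhoE' V W U (e : 'I_m.*2 -> vfield M) : open U -> (forall i, theta (e i) = 0) ->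
    (forall p, U p -> forall i j, metric theta J' (e i) (e j) p = (i == j)%:R) ->
    forall p, U p -> rho V W p = 2^-1 * \sum_l
      metric theta J' (curv nabla (J' (e l)) (e l) (hproj theta T V)) (hproj theta T W) p.
  move=> oU he eo p Up; rewrite (rhoE V W U e oU (frameE _ _ he eo) p Up).
  congr (_ * _); apply: eq_bigr => l _.
  by rewrite curvE J'E// gE.
have hRic : theta (Ric T) = 0.
  exact: (theta_Ric thetaT wT J'lin thetaJ' J'J' i1 conn nablaT nablaH' subH HE gpos' RicE').
rewrite /dW (d2_ricci_form thetaT wT J'lin thetaJ' J'J' i1 i2 nondeg conn nablaT
  nablaH' gmetric' tors' charE' subH HE gpos' RicE' rhoE')//.
rewrite /wedge12 /flat !gE// !wE J'E//.
(* The projections inside [dtheta] disappear because its contraction with [T] is zero. *)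
by rewrite !(dform_hprojl, dform_hprojr).
Qed.
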